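(* There is a kernel $\kappa$ from $S\times S$ to $G$ such that $$\int f(gs,g)\,\lambda(dg)=\iint f(t,g)\,\kappa_{s,t}(dg)\,\mu_s(dt)$$ for all $s\in S$ and all measurable $f:S\times G\to[0,\infty]$, and moreover: (i) $\kappa_{s,gt}=\kappa_{s,t}\circ\theta_g^{-1}$ for all $g\in G$, $s,t\in S$, where $\theta_g(h)=gh$; (ii) $\kappa_{s,t}$ is concentrated on $G_{s,t}:=\{g\in G:gs=t\}$ for all $s\in S$, $t\in Gs$; (iii) $\kappa_{s,t}(G)=1$ for all $s\in S$, $t\in Gs$.
   Context: $G$ is a locally compact second countable Hausdorff group with Borel $\sigma$-field and fixed left Haar measure $\lambda$. $(S,\mathcal S)$ is a Borel space on which $G$ acts measurably. For $s\in S$, $\mu_s$ is the image of $\lambda$ under $g\mapsto gs$. The action is proper: there exists a measurable partition $B_1,B_2,\dots$ of $S$ with $\mu_s(B_n)<\infty$ for all $s\in S$, $n\in\mathbb N$. A kernel from $S\times S$ to $G$ is a map $\kappa$ with $(s,t)\mapsto\kappa_{s,t}(A)$ measurable for each Borel $A\subseteq G$ and each $\kappa_{s,t}$ a measure. *)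

(* Defs.v *)
From HB Require Import structures.
From mathcomp Require Import all_boot all_order all_algebra.
From mathcomp Require Import all_classical all_reals all_analysis measurable_realfun.
Set Implicit Arguments. Unset Strict Implicit. Unset Printing Implicit Defensive.
Import Order.TTheory GRing.Theory Num.Theory.
Local Open Scope classical_set_scope.
Local Open Scope ring_scope.

Notation borel G := (g_sigma_algebraType (@open G)).

Definition lcsc_group (G : ptopologicalType)
    (mul : G -> G -> G) (inv : G -> G) (e : G) : Prop :=
  [/\ (forall x y z, mul x (mul y z) = mul (mul x y) z),
      (forall x, mul e x = x) &
      (forall x, mul (inv x) x = e)] /\
  [/\ continuous (fun p : G * G => mul p.1 p.2),
      continuous inv,
      hausdorff_space G,
      locally_compact [set: G] &
      @second_countable G].

(** [lam] is a (left) Haar measure on the Borel sets of the lcsc group [G]: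
    a nonzero, left-invariant measure that is finite on compact sets
    (on an lcsc space such a measure is automatically Radon/regular). *)
Definition haar_measure (R : realType) (G : ptopologicalType)
    (mul : G -> G -> G) (lam : set (borel G) -> \bar R) : Prop :=
  [/\ (forall (g : G) (A : set (borel G)), measurable A ->
         lam [set mul g h | h in A] = lam A),
      (forall K : set G, compact K -> (lam K < +oo)%E) &
      (0 < lam setT)%E].

(** A Borel space: a measurable space Borel-isomorphic to a Borel subset of
    the real line (equivalently of [0,1]). *)
Definition borel_space (R : realType) d (S : measurableType d) : Prop :=
  exists phi : S -> R,
    [/\ measurable_fun setT phi, injective phi &
        forall A : set S, measurable A -> measurable (phi @` A)].

Definition measurable_action (G : ptopologicalType) (mul : G -> G -> G)
    (e : G) d (S : measurableType d) (act : G -> S -> S) : Prop :=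
  [/\ (forall s, act e s = s),
      (forall g h s, act (mul g h) s = act g (act h s)) &
      measurable_fun setT (fun p : (borel G * S)%type => act p.1 p.2)].

Definition orbit_measure (R : realType) (G : ptopologicalType) d
    (S : measurableType d) (act : G -> S -> S)
    (lam : set (borel G) -> \bar R) (s : S) : set S -> \bar R :=
  pushforward lam (fun g : borel G => act g s).

Definition proper_action (R : realType) (G : ptopologicalType) d
    (S : measurableType d) (act : G -> S -> S)
    (lam : set (borel G) -> \bar R) : Prop :=
  exists B : nat -> set S,
    [/\ (forall n, measurable (B n)),
        trivIset setT B,
        \bigcup_n B n = setT &
        forall s n, (orbit_measure act lam s (B n) < +oo)%E].

(* Main.v *)
(* Properness makes the weight w(s, t) = 2^-n / (1 + mu_s(B_n)), for t in B_n, positive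
   and mu_s-integrable, so w(s, gs) lam(dg) is a finite measure. Conditioning it on gs
   gives a probability kernel kappa', measurable in (s, t), which satisfies the required
   identity but is invariant only up to null sets. Averaging over the group,
     kappa_{s,t}(A) = \int w(s, gt) kappa'_{s,gt}(gA /\ G_{s,gt}) lam(dg)
                      / \int w(s, gt) lam(dg),
   makes the invariance exact: replacing t by kt multiplies numerator and denominator
   by the same modular factor of k, because right translates of lam are proportional to lam.
   By Fubini and left invariance the averaged kernel still satisfies the identity, and the
   restriction to G_{s,gt} makes it vanish off the orbit of s.

   For kappa', densities are obtained measurably in a parameter as the limit of an
   L2-bounded martingale along a parameter-dependent fast subsequence; G is embedded in
   the Cantor space through a countable base, and a random point of G with law
   kappa'_{s,t} is produced from a uniform variable, choosing one digit after another. *)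

(* The identity determines [kappa_{s,t}] only up to a [mu_s]-null set of [t], and the null set on
   which a given disintegration fails to be invariant varies with [g]. Corrections for one [g] at a
   time therefore cannot give (i) for all [g] at once. The second obstacle is measurability in [s]:
   densities chosen for each [s] separately do not form a kernel, so the density has to be an
   explicit limit of quotients of cell masses. The measures compared are nested, so the quotients
   lie in [0, 1] and their energies are bounded by the total mass. Along the fast subsequence the
   increments are summable in L1, which gives convergence almost everywhere without a maximal
   inequality. A random point [Z s t u] is handier than the kernel [kappa'] itself: integrals
   against its law are integrals over [u], so composition and Tonelli yield every later
   measurability statement. *)
Require Import Defs.
From HB Require Import structures.
From mathcomp Require Import all_boot all_order all_algebra.
From mathcomp Require Import all_classical all_reals all_analysis measurable_realfun.
From mathcomp Require Import ring lra.
Set Implicit Arguments.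
Unset Strict Implicit.
Unset Printing Implicit Defensive.
Import Order.TTheory GRing.Theory Num.Theory.
Import numFieldNormedType.Exports.
Local Open Scope classical_set_scope.
Local Open Scope ring_scope.
Local Open Scope ereal_scope.

(** * Measures with densities and integrals on a group *)

(** Serves each time a countable-valued selector picks one of countably many measurable functions:
    the cell of a point, the fast index, the member of the partition. *)
Lemma measurable_fun_glue d d' (X : measurableType d) (Y : measurableType d')
    (I : countType) (N : X -> I) (h : I -> X -> Y) :
  (forall i, measurable [set x | N x = i]) ->
  (forall i, measurable_fun setT (h i)) ->
  measurable_fun setT (fun x => h (N x) x).
Proof.
move=> mN mh _ B mB; rewrite setTI.
rewrite (_ : _ @^-1` B = \bigcup_i ([set x | N x = i] `&` h i @^-1` B)).
  apply: countable_bigcupT_measurable => // i.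
  by apply: measurableI => //; rewrite -[_ @^-1` _]setTI; exact: mh.
by apply/seteqP; split => [x Bx|x [i _ [/= <-]]//]; exists (N x).
Qed.

Lemma measurable_count_preimage d (X : measurableType d) (I : countType)
    (N : X -> I) (B : set I) :
  (forall i, measurable [set x | N x = i]) -> measurable (N @^-1` B).
Proof.
move=> mN; rewrite (_ : _ @^-1` B = \bigcup_(i in B) [set x | N x = i]).
  rewrite bigcup_mkcond; apply: countable_bigcupT_measurable => // i.
  by case: ifP.
by apply/seteqP; split => [x Bx|x [i Bi /= ->]//]; exists (N x).
Qed.

(** Inversion, with value 0 at 0, is not continuous there; on nonnegative reals it is the power of
    exponent -1. *)
Lemma measurable_fun_invr_ge0 d (X : measurableType d) (R : realType)
    (f : X -> R) : (forall x, (0 <= f x)%R) -> measurable_fun setT f ->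
  measurable_fun setT (fun x => (f x)^-1%R).
Proof.
move=> f0 mf; under eq_fun do rewrite -powR_inv1//.
exact: (measurableT_comp (@measurable_powR R (-1))).
Qed.

Lemma measurable_indic_comp d d' (X : measurableType d) (Y : measurableType d')
    (R : realType) (f : X -> Y) (A : set Y) :
  measurable A -> measurable_fun setT f ->
  measurable_fun setT (fun x => \1_A (f x) : R).
Proof. by move=> mA mf; apply: measurableT_comp mf; exact: measurable_indic. Qed.

Lemma measurable_EFin_indic d d' (X : measurableType d) (Y : measurableType d')
    (R : realType) (f : X -> Y) (A : set Y) :
  measurable A -> measurable_fun setT f ->
  measurable_fun setT (fun x => (\1_A (f x))%:E : \bar R).
Proof. by move=> mA mf; apply/measurable_EFinP; exact: measurable_indic_comp. Qed.

Section density_pushforward.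
Context d d' (T : measurableType d) (T' : measurableType d') (R : realType).
Variables (mu : {measure set T -> \bar R}) (k : T -> R) (Phi : T -> T').
Hypotheses (k0 : forall x, (0 <= k x)%R) (mk : measurable_fun setT k)
  (mPhi : measurable_fun setT Phi).

(** The image under [Phi] of the measure with density [k]. Prefix laws, comparison measures, the
    final kernel and the uniform measure all have this form. *)
Definition density_pushforward (A : set T') : \bar R :=
  \int[mu]_x ((k x)%:E * (\1_A (Phi x))%:E).

Let mu0 : density_pushforward set0 = 0.
Proof. by apply: integral0_eq => x _; rewrite indic0 mule0. Qed.

Let integrand_ge0 A x : 0 <= (k x)%:E * (\1_A (Phi x))%:E.
Proof. by rewrite mule_ge0// lee_fin. Qed.

Let mu_ge0 A : 0 <= density_pushforward A.
Proof. by apply: integral_ge0. Qed.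

Let measurable_integrand A : measurable A ->
  measurable_fun setT (fun x => (k x)%:E * (\1_A (Phi x))%:E).
Proof.
move=> mA; apply: emeasurable_funM; apply/measurable_EFinP => //.
by apply: measurableT_comp mPhi; exact: measurable_indic.
Qed.

Let mu_sigma_additive : semi_sigma_additive density_pushforward.
Proof.
move=> U mU tU mUU; rewrite [X in _ --> X](_ : _ =
  \int[mu]_x (\sum_(n <oo) ((k x)%:E * (\1_(U n) (Phi x))%:E))); last first.
  apply: eq_integral => x _.
  rewrite nneseriesZl; last by move=> i _; rewrite lee_fin.
  congr (_ * _); apply/esym/cvg_lim => //.
  exact: (@measure_semi_sigma_additive _ _ _
    (dirac (Phi x) : {measure set T' -> \bar R}) U mU tU mUU).
apply/cvg_closeP; split.
  by apply: is_cvg_nneseries => n _ _; exact: mu_ge0.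
rewrite closeE// integral_nneseries//.
by move=> n; exact: measurable_integrand.
Qed.

HB.instance Definition _ := isMeasure.Build _ _ _
  density_pushforward mu0 mu_ge0 mu_sigma_additive.

Definition mdensity_pushforward : {measure set T' -> \bar R} :=
  density_pushforward.

Import HBNNSimple.

Lemma integral_density_pushforward (f : T' -> \bar R) :
  (forall y, 0 <= f y) -> measurable_fun setT f ->
  \int[mdensity_pushforward]_y f y = \int[mu]_x ((k x)%:E * f (Phi x)).
Proof.
move=> f0 mf.
pose f_ := nnsfun_approx measurableT mf.
transitivity (limn (fun n => \int[mdensity_pushforward]_x (f_ n x)%:E)).
  rewrite -monotone_convergence//.
  - apply: eq_integral => y _; apply/esym/cvg_lim => //.
    exact: cvg_nnsfun_approx.
  - by move=> n; exact/measurable_EFinP.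
  - by move=> n y _; rewrite lee_fin.
  - by move=> y _ m n mn; rewrite lee_fin; exact/lefP/nd_nnsfun_approx.
transitivity (limn (fun n => \int[mu]_x ((k x)%:E * (f_ n (Phi x))%:E))); last first.
  rewrite -monotone_convergence//; last 3 first.
  - move=> n; apply: emeasurable_funM; apply/measurable_EFinP => //.
    exact: measurableT_comp.
  - by move=> n x _; rewrite mule_ge0// lee_fin.
  - move=> x _ m n mn; rewrite lee_wpmul2l// lee_fin//.
    exact/lefP/nd_nnsfun_approx.
  apply: eq_integral => x _; apply/cvg_lim => //.
  by apply: cvgeZl => //; exact: cvg_nnsfun_approx.
congr (limn _); apply/funext => n.
under [LHS]eq_integral do rewrite fimfunE -fsumEFin//.
rewrite ge0_integral_fsum//; last 2 first.
  - by move=> y; exact/measurable_EFinP/measurable_funM.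
  - by move=> y x _; rewrite nnfun_muleindic_ge0.
transitivity (\int[mu]_x
    \sum_(r \in range (f_ n)) ((k x)%:E * (r * \1_(f_ n @^-1` [set r]) (Phi x))%:E)).
  rewrite ge0_integral_fsum//; last 2 first.
  - move=> y; apply: emeasurable_funM; apply/measurable_EFinP => //.
    apply: measurable_funM => //.
    by apply: measurableT_comp mPhi; exact: measurable_indic.
  - by move=> y x _; rewrite mule_ge0 ?lee_fin// -lee_fin EFinM nnfun_muleindic_ge0.
  apply: eq_fsbigr => r _.
  rewrite integralZl_indic_nnsfun// integral_indic// setIT.
  rewrite /density_pushforward.
  (* Only a nonnegative scalar may be moved across the integral here; for [r < 0] the level set is
     empty. *)
  have [r0|r0] := leP 0%R r.
    rewrite -ge0_integralZl//; last exact: measurable_integrand.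
    by apply: eq_integral => x _; rewrite EFinM muleCA.
  rewrite preimage_nnfun0//.
  rewrite [X in _ * X]integral0_eq ?mule0; last first.
    by move=> x _; rewrite indic0 mule0.
  by rewrite integral0_eq// => x _; rewrite indic0 mulr0 mule0.
apply: eq_integral => x _.
rewrite -ge0_mule_fsumr; last by move=> y; rewrite nnfun_muleindic_ge0.
by rewrite fsumEFin// -fimfunE.
Qed.

End density_pushforward.

(** * Haar measure under inversion and right translation *)

Section group_integral.
Context d (H : measurableType d) (mul : H -> H -> H) (inv : H -> H) (e : H)
  (R : realType) (lam : {sigma_finite_measure set H -> \bar R}).
Hypotheses (mulA : forall x y z, mul x (mul y z) = mul (mul x y) z)
  (mul1 : forall x, mul e x = x) (mulV : forall x, mul (inv x) x = e)
  (mmul : measurable_fun setT (fun p : H * H => mul p.1 p.2))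
  (minv : measurable_fun setT inv)
  (lamE : forall g A, measurable A -> lam [set mul g h | h in A] = lam A).

Lemma grp_mulVr x : mul x (inv x) = e.
Proof.
rewrite -[LHS]mul1 -[in LHS](mulV (inv x)) -mulA.
by rewrite (mulA (inv x) x) mulV mul1 mulV.
Qed.

Lemma grp_mul1r x : mul x e = x.
Proof. by rewrite -(mulV x) mulA grp_mulVr mul1. Qed.

Lemma grp_mulK x y : mul (inv x) (mul x y) = y.
Proof. by rewrite mulA mulV mul1. Qed.

Lemma grp_mulVK x y : mul x (mul (inv x) y) = y.
Proof. by rewrite mulA grp_mulVr mul1. Qed.

Lemma grp_invM x y : inv (mul x y) = mul (inv y) (inv x).
Proof.
rewrite -[RHS]mul1 -(mulV (mul x y)) -!mulA.
by rewrite (mulA y) grp_mulVr mul1 grp_mulVr grp_mul1r.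
Qed.

Lemma grp_invK x : inv (inv x) = x.
Proof. by rewrite -[LHS]grp_mul1r -(mulV x) mulA mulV mul1. Qed.

Lemma measurable_grp_mul d' (X : measurableType d') (f g : X -> H) :
  measurable_fun setT f -> measurable_fun setT g ->
  measurable_fun setT (fun x => mul (f x) (g x)).
Proof.
move=> mf mg.
exact: (measurableT_comp mmul (measurable_fun_pair mf mg)).
Qed.

Lemma measurable_grp_inv d' (X : measurableType d') (f : X -> H) :
  measurable_fun setT f -> measurable_fun setT (fun x => inv (f x)).
Proof. by move=> mf; exact: (measurableT_comp minv mf). Qed.

Lemma integral_mull g (F : H -> \bar R) :
  (forall x, 0 <= F x) -> measurable_fun setT F ->
  \int[lam]_x F (mul g x) = \int[lam]_x F x.
Proof.
move=> F0 mF.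
have mg : measurable_fun setT (mul g) by exact: measurable_grp_mul.
rewrite -(@ge0_integral_pushforward _ _ _ _ _ _ mg lam setT F)//.
apply: eq_measure_integral => A mA _.
rewrite -[RHS](lamE (inv g))//; congr (lam _).
apply/seteqP; split=> [x /= Ax|_ [h Ah <-]].
  by exists (mul g x) => //; rewrite grp_mulK.
by rewrite /= grp_mulVK.
Qed.

Lemma measurable_int2 d' (X : measurableType d') (F : X * H -> \bar R) :
  (forall x, 0 <= F x) -> measurable_fun setT F ->
  measurable_fun setT (fun x => \int[lam]_g F (x, g)).
Proof. by move=> F0 mF; exact: measurable_fun_fubini_tonelli_F. Qed.

(** Two left translations around an exchange of integrals: [y] becomes [x^-1 y], then [x] becomes
    [y x]. This leaves [g] at [x^-1] and turns the argument of [f] into [y x k]. *)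
Lemma haar_fubini (f g : H -> \bar R) k :
  (forall x, 0 <= f x) -> measurable_fun setT f ->
  (forall x, 0 <= g x) -> measurable_fun setT g ->
  \int[lam]_x f (mul x k) * \int[lam]_y g y
  = \int[lam]_x (g (inv x) * \int[lam]_y f (mul y (mul x k))).
Proof.
move=> f0 mf g0 mg.
have mr z : measurable_fun setT (fun y => f (mul y z)).
  by apply: (measurableT_comp mf); exact: measurable_grp_mul.
rewrite muleC -ge0_integralZl//; last exact: integral_ge0.
transitivity (\int[lam]_x \int[lam]_y (f (mul x k) * g (mul (inv x) y))).
  apply: eq_integral => x _; rewrite muleC ge0_integralZl//; last first.
    by apply: (measurableT_comp mg); exact: measurable_grp_mul.
  by rewrite (integral_mull (inv x)).
rewrite (fubini_tonelli (fun p => f (mul p.1 k) * g (mul (inv p.1) p.2))) /=;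
  last 2 first.
- apply: emeasurable_funM.
    by apply: (measurableT_comp mf); exact: measurable_grp_mul.
  apply: (measurableT_comp mg); apply: measurable_grp_mul => //.
  exact: measurable_grp_inv.
- by move=> p; rewrite mule_ge0.
transitivity (\int[lam]_y \int[lam]_x (g (inv x) * f (mul y (mul x k)))).
  apply: eq_integral => y _.
  rewrite -(integral_mull y); last 2 first.
  - by move=> x; rewrite mule_ge0.
  - apply: emeasurable_funM => //.
    by apply: (measurableT_comp mg); apply: measurable_grp_mul => //;
      exact: measurable_grp_inv.
  apply: eq_integral => x _.
  by rewrite muleC grp_invM -(mulA (inv x)) mulV grp_mul1r mulA.
rewrite -(fubini_tonelli (fun p => g (inv p.1) * f (mul p.2 (mul p.1 k)))) /=;
  last 2 first.
- apply: emeasurable_funM.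
    by apply: (measurableT_comp mg); exact: measurable_grp_inv.
  apply: (measurableT_comp mf); apply: measurable_grp_mul => //.
  exact: measurable_grp_mul.
- by move=> p; rewrite mule_ge0.
by apply: eq_integral => x _; rewrite ge0_integralZl.
Qed.

Hypothesis lamT : lam setT != 0.

(** Integrate the indicator of [A] at [y^-1 x] over both variables. Over [x] first, left invariance
    gives 0; over [y] first, it gives the measure of the inverse of [A] for every [x], and [lam] is
    nonzero. *)
Lemma haar_inv_null A : measurable A ->
  \int[lam]_x (\1_A x)%:E = 0 -> \int[lam]_x (\1_A (inv x))%:E = 0.
Proof.
move=> mA A0; set c := LHS.
have : \int[lam]_x \int[lam]_y (\1_A (mul (inv y) x))%:E = 0.
  rewrite (fubini_tonelli (fun p => (\1_A (mul (inv p.2) p.1))%:E : \bar R)) /=;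
    last 2 first.
  - apply: measurable_EFin_indic => //; apply: measurable_grp_mul => //.
    exact: measurable_grp_inv.
  - by move=> p; rewrite lee_fin.
  apply: integral0_eq => y _; rewrite (@integral_mull (inv y) (fun x => (\1_A x)%:E))//.
  exact: measurable_EFin_indic.
rewrite (eq_integral (cst c)); last first.
  move=> x _; rewrite -(integral_mull x); last 2 first.
  - by move=> y; rewrite lee_fin.
  - apply: measurable_EFin_indic => //; apply: measurable_grp_mul => //.
  by apply: eq_integral => y _; rewrite grp_invM -mulA mulV grp_mul1r.
rewrite integral_cst// => /eqP; rewrite mule_eq0 (negbTE lamT) orbF.
by move/eqP.
Qed.

(** This constant is the source of the modular factor. The set [A] is a yardstick: its right
    translates all have finite positive measure, so they can be divided by. *)
Lemma haar_mulr (A : set H) k : measurable A ->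
  lam A != 0 -> (forall x, \int[lam]_y (\1_A (mul y x))%:E < +oo) ->
  exists2 c : R, (0 < c)%R & forall F : H -> \bar R,
    (forall x, 0 <= F x) -> measurable_fun setT F ->
    \int[lam]_x F (mul x k) = c%:E * \int[lam]_x F x.
Proof.
move=> mA A0 Afin.
pose f y : \bar R := (\1_A y)%:E.
have f0 y : 0 <= f y by rewrite lee_fin.
have mf : measurable_fun setT f by exact: measurable_EFin_indic.
pose D x := \int[lam]_y f (mul y x).
have D0 x : 0 <= D x by exact: integral_ge0.
have mD : measurable_fun setT D.
  apply: (@measurable_int2 _ _ (fun p => f (mul p.2 p.1))) => //.
  by apply: (measurableT_comp mf); exact: measurable_grp_mul.
have Dfin x : D x \is a fin_num by rewrite ge0_fin_numE//; exact: Afin.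
have Dgt0 x : (0 < fine (D x))%R.
  apply: fine_gt0; rewrite Afin andbT lt_neqAle D0 andbT eq_sym.
  (* If the right translate of [A] by [x^-1] is null, so is its inverse, a left translate of the
     inverse of [A]; inverting once more makes [A] null. *)
  apply: contra A0 => /eqP Dx0.
  have mB : measurable [set y | A (mul y x)].
    rewrite -[X in measurable X]setTI.
    have mx : measurable_fun setT (fun y => mul y x).
      exact: measurable_grp_mul.
    exact: (mx measurableT _ mA).
  have := @haar_inv_null _ mB.
  have -> : \int[lam]_y (\1_[set y | A (mul y x)] y)%:E = D x by [].
  move=> /(_ Dx0).
  rewrite -(integral_mull (x)); last 2 first.
  - by move=> y; rewrite lee_fin.
  - apply: measurable_EFin_indic => //.
  have mAi : measurable (inv @^-1` A).
    by rewrite -[X in measurable X]setTI; exact: minv.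
  move=> B0; have := @haar_inv_null _ mAi.
  have -> : \int[lam]_y (\1_(inv @^-1` A) y)%:E = 0.
    rewrite -[RHS]B0; apply: eq_integral => y _; rewrite !indicE.
    congr ((_ : bool)%:R%:E); apply/idP/idP; rewrite !inE /=;
      by rewrite grp_invM -mulA mulV grp_mul1r.
  move=> /(_ erefl); rewrite (eq_integral (fun y => (\1_A y)%:E)).
    by rewrite integral_indic// setIT => ->.
  move=> y _; rewrite !indicE.
  by congr ((_ : bool)%:R%:E); apply/idP/idP; rewrite !inE /= grp_invK.
have mDi : measurable_fun setT (fun x => (fine (D x))^-1%R).
  apply: measurable_fun_invr_ge0; first by move=> x; exact: ltW.
  exact: measurableT_comp.
(* The quotient of [key] at [z = k] and at [z = e], where the remaining integral is the same. *)
exists (fine (D k) / fine (D e))%R; first by rewrite divr_gt0.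
move=> F F0 mF.
pose h x := F x * (fine (D x))^-1%:E.
have h0 x : 0 <= h x by rewrite mule_ge0// lee_fin invr_ge0 ltW.
have mh : measurable_fun setT h.
  by apply: emeasurable_funM => //; exact/measurable_EFinP.
(* [haar_fubini] with [f] the indicator of [A]: the right translates of [lam] are
   determined by the values [D]. *)
have key z : \int[lam]_x F (mul x z) = D z * \int[lam]_y h (inv y).
  have -> : \int[lam]_y h (inv y) = \int[lam]_y h (mul (inv y) z).
    rewrite -[RHS](integral_mull z).
    - by apply: eq_integral => y _; rewrite grp_invM -mulA mulV grp_mul1r.
    - by [].
    - apply: (measurableT_comp mh); apply: measurable_grp_mul => //.
  rewrite (haar_fubini (g := fun y => h (mul (inv y) z)))//; last first.
    by apply: (measurableT_comp mh); apply: measurable_grp_mul.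
  apply: eq_integral => x _; rewrite grp_invK -/(D _) /h.
  rewrite -muleA -[X in _ * (_ * X)](fineK (Dfin _)) -EFinM mulVf ?mule1//.
  by rewrite gt_eqF.
have -> : \int[lam]_x F x = \int[lam]_x F (mul x e).
  by apply: eq_integral => x _; rewrite grp_mul1r.
rewrite !key muleA; congr (_ * _).
rewrite -[X in _ * X](fineK (Dfin _)) -EFinM divfK ?fineK//.
by rewrite gt_eqF.
Qed.

End group_integral.

(** * Radon-Nikodym derivatives depending measurably on a parameter *)

Lemma integral_count d (S : measurableType d) (R : realType)
    (m : {measure set S -> \bar R}) (N : S -> nat) (h : nat -> \bar R) :
  (forall c, measurable [set t | N t = c]) -> (forall c, 0 <= h c) ->
  \int[m]_t h (N t) = \sum_(c <oo) (h c * m [set t | N t = c]).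
Proof.
move=> mN h0.
have NT : [set: S] = \bigcup_c [set t | N t = c].
  by apply/seteqP; split => // t _; exists (N t).
rewrite NT ge0_integral_bigcup//.
- apply: eq_eseriesr => c _.
  rewrite (eq_integral (cst (h c))) ?integral_cst//.
  by move=> t; rewrite inE /= => ->.
- rewrite -NT; exact: (@measurable_fun_glue _ _ _ _ _ N (fun c => cst (h c))).
- by apply/trivIsetP => i j _ _ ij; rewrite -subset0 => t [/= ->] /eqP; rewrite (negbTE ij).
Qed.

Section kernel_Radon_Nikodym.
Context d d' (X : measurableType d) (S : measurableType d') (R : realType)
  (mu nu : X -> {measure set S -> \bar R}) (C : nat -> set S).
Hypotheses
  (mmu : forall A, measurable A -> measurable_fun setT (fun x => mu x A))
  (mnu : forall A, measurable A -> measurable_fun setT (fun x => nu x A))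
  (numu : forall x A, measurable A -> nu x A <= mu x A)
  (muoo : forall x, mu x setT < +oo)
  (mC : forall n, measurable (C n))
  (genC : @measurable _ S `<=` <<s range C>>).

(** A number for the atom of [t] in the algebra generated by the first [n] sets. The latest test is
    the lowest binary digit, so halving forgets it and parity reads it. *)
Fixpoint cell (n : nat) (t : S) : nat :=
  if n is n'.+1 then ((t \in C n') + (cell n' t).*2)%N else 0%N.

Lemma measurable_cell n c : measurable [set t | cell n t = c].
Proof.
elim: n c => [|n IH] c /=.
  have [->|c0] := eqVneq c 0%N.
    by rewrite (_ : [set _ | _] = setT)//; apply/seteqP; split.
  rewrite (_ : [set _ | _] = set0)//; apply/seteqP; split => // t /= /esym/eqP.
  by rewrite (negbTE c0).
rewrite (_ : [set _ | _] =
    (C n `&` cell n @^-1` [set a | (1 + a.*2)%N = c]) `|`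
    (~` C n `&` cell n @^-1` [set a | a.*2 = c])).
  apply: measurableU; apply: measurableI => //; do ?exact: measurableC;
    exact: measurable_count_preimage.
apply/seteqP; split => [t /=|t /= [[Ct]|[Ct]]].
- case: (boolP (t \in C n)) => [/set_mem|/negP nC] ?; [by left|right].
  by split => //; apply: contra_not nC => /mem_set.
- by rewrite mem_set.
- by rewrite memNset.
Qed.

Lemma measurable_cellB n (B : set nat) : measurable (cell n @^-1` B).
Proof. by apply: measurable_count_preimage; exact: measurable_cell. Qed.

Lemma cell_coarsen n m : (n <= m)%N -> exists h, forall t, cell n t = h (cell m t).
Proof.
move=> /subnK <-; elim: (m - n)%N => [|k [h hE]]; first by exists id.
exists (fun c => h c./2) => t; rewrite hE addSn /=; congr (h _).
by case: (t \in C _); rewrite ?add1n ?add0n ?uphalf_double ?doubleK //= uphalf_double.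
Qed.

Let mass (m : X -> {measure set S -> \bar R}) n c x : R :=
  fine (m x [set t | cell n t = c]).

Let ratio n c x : R := (mass nu n c x / mass mu n c x)%R.

(** The conditional expectation, given the cell at level [n], of the density still to be found. On
    [mu x]-null cells it is 0, by the convention for division. *)
Definition cell_average n x t : R := ratio n (cell n t) x.

Local Notation E := cell_average.

Let muoo' x A : measurable A -> mu x A < +oo.
Proof.
by move=> mA; apply: le_lt_trans (muoo x); apply: le_measure; rewrite ?inE.
Qed.

Let mufin x A : measurable A -> mu x A \is a fin_num.
Proof. by move=> mA; rewrite ge0_fin_numE//; exact: muoo'. Qed.

Let nufin x A : measurable A -> nu x A \is a fin_num.
Proof.
move=> mA; rewrite ge0_fin_numE//; apply: le_lt_trans (muoo' x mA).
exact: numu.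
Qed.

Let ratio_ge0 n c x : (0 <= ratio n c x)%R.
Proof. by rewrite divr_ge0// fine_ge0. Qed.

Let ratio_le1 n c x : (ratio n c x <= 1)%R.
Proof.
rewrite /ratio; have mc := measurable_cell n c.
have [->|m0] := eqVneq (mass mu n c x) 0%R; first by rewrite invr0 mulr0.
rewrite ler_pdivrMr ?mul1r ?lt_neqAle ?(eq_sym 0%R) ?m0 ?fine_ge0//.
by apply: fine_le; [exact: nufin|exact: mufin|exact: numu].
Qed.

Lemma cell_average_ge0 n x t : (0 <= E n x t)%R. Proof. exact: ratio_ge0. Qed.
Lemma cell_average_le1 n x t : (E n x t <= 1)%R. Proof. exact: ratio_le1. Qed.

Let measurable_ratio n c : measurable_fun setT (ratio n c).
Proof.
have mm (m : X -> {measure set S -> \bar R}) :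
    (forall A, measurable A -> measurable_fun setT (fun x => m x A)) ->
    measurable_fun setT (mass m n c).
  by move=> h; apply: measurableT_comp => //; apply: h; exact: measurable_cell.
apply: measurable_funM; first exact: mm.
apply: measurable_fun_invr_ge0; last exact: mm.
by move=> x; exact: fine_ge0.
Qed.

Lemma measurable_cell_average n :
  measurable_fun setT (fun p : X * S => E n p.1 p.2).
Proof.
apply: (@measurable_fun_glue _ _ _ _ _ (fun p : X * S => cell n p.2)
  (fun c p => ratio n c p.1)) => [c|c].
  have := @measurable_snd _ _ X S measurableT _ (measurable_cell n c).
  by rewrite setTI.
exact: measurableT_comp.
Qed.

Lemma measurable_cell_average2 n x : measurable_fun setT (E n x).
Proof.
exact: (@measurable_fun_glue _ _ _ _ _ (cell n) (fun c => cst (ratio n c x))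
  (measurable_cell n)).
Qed.

Lemma integral_cell_average n x (b : nat -> R) : (forall c, (0 <= b c)%R) ->
  \int[mu x]_t (E n x t * b (cell n t))%:E = \int[nu x]_t (b (cell n t))%:E.
Proof.
move=> b0.
rewrite (integral_count _ (measurable_cell n) (h := fun c => (b c)%:E)); last first.
  by move=> c; rewrite lee_fin.
rewrite (integral_count _ (measurable_cell n)
  (h := fun c => (ratio n c x * b c)%:E)); last first.
  by move=> c; rewrite lee_fin mulr_ge0.
apply: eq_eseriesr => c _; have mc := measurable_cell n c.
rewrite -[in LHS](fineK (mufin x mc)) -[in RHS](fineK (nufin x mc)) -!EFinM.
congr (_%:E); rewrite /ratio mulrAC mulrC -/(mass mu n c x) -/(mass nu n c x).
(* On a null cell of [mu x] the quotient carries no information, but domination makes the cell null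
   for [nu x] too. *)
have [m0|m0] := eqVneq (mass mu n c x) 0%R; last by rewrite divfK.
suff -> : mass nu n c x = 0%R by rewrite m0 !mul0r mulr0.
apply/eqP; rewrite eq_le fine_ge0// andbT -m0.
by apply: fine_le; [exact: nufin|exact: mufin|exact: numu].
Qed.

Let e n x : R := fine (\int[mu x]_t (E n x t ^+ 2)%:E).

Let le1_fin x (f : S -> R) : measurable_fun setT f ->
  (forall t, (0 <= f t <= 1)%R) ->
  0 <= \int[mu x]_t (f t)%:E <= mu x setT.
Proof.
move=> mf f01; apply/andP; split.
  by apply: integral_ge0 => t _; rewrite lee_fin; case/andP: (f01 t).
rewrite -[leRHS]mul1e -(integral_cst _ measurableT).
apply: ge0_le_integral => //.
- by move=> t _; rewrite lee_fin; case/andP: (f01 t).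
- exact/measurable_EFinP.
- by move=> t _; rewrite lee_fin; case/andP: (f01 t).
Qed.

Let mE2 n x : measurable_fun setT (fun t => E n x t ^+ 2)%R.
Proof. by apply: measurable_funX; exact: measurable_cell_average2. Qed.

Let E01 n x t : (0 <= E n x t ^+ 2 <= 1)%R.
Proof.
by rewrite exprn_ge0 ?cell_average_ge0//= exprn_ile1// ?cell_average_ge0 ?cell_average_le1.
Qed.

Let intE2 n x : \int[mu x]_t (E n x t ^+ 2)%:E = (e n x)%:E.
Proof.
rewrite fineK//; have /andP[i0 i1] := le1_fin x (mE2 n x) (E01 n x).
by rewrite ge0_fin_numE//; exact: le_lt_trans (muoo x).
Qed.

Let e_le n x : (e n x <= fine (mu x setT))%R.
Proof.
rewrite -lee_fin -intE2 fineK ?mufin//.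
by case/andP: (le1_fin x (mE2 n x) (E01 n x)).
Qed.

(** The coarser average is constant on the finer cells, so both sides equal its integral against
    [nu x]. *)
Let cross n m x : (n <= m)%N ->
  \int[mu x]_t (E m x t * E n x t)%:E = (e n x)%:E.
Proof.
move=> nm; have [h hE] := cell_coarsen nm.
transitivity (\int[nu x]_t (E n x t)%:E).
  under [in RHS]eq_integral do rewrite /cell_average hE.
  rewrite -(integral_cell_average m x (b := fun c => ratio n (h c) x))//.
  by apply: eq_integral => t _; rewrite -hE.
rewrite -intE2 -(integral_cell_average n x (b := fun c => ratio n c x))//.
Qed.

(* Orthogonality of martingale increments. *)
Lemma cell_average_dist n m x : (n <= m)%N ->
  \int[mu x]_t ((E m x t - E n x t) ^+ 2)%:E = (e m x - e n x)%:E.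
Proof.
move=> nm.
have mEn k : measurable_fun setT (E k x) by exact: measurable_cell_average2.
(* The expanded square with its negative cross term moved across, so that only nonnegative
   integrands are added. *)
have H : \int[mu x]_t ((E m x t - E n x t) ^+ 2)%:E + ((e n x)%:E + (e n x)%:E) =
    (e m x)%:E + (e n x)%:E.
  rewrite -{1 2}(cross x nm) -!intE2.
  have mcr : measurable_fun setT (fun t => (E m x t * E n x t)%:E : \bar R).
    by apply/measurable_EFinP; exact: measurable_funM.
  have cr0 t : 0 <= (E m x t * E n x t)%:E.
    by rewrite lee_fin mulr_ge0// cell_average_ge0.
  rewrite -[X in _ + X]ge0_integralD// -!ge0_integralD//.
  - apply: eq_integral => t _; rewrite -!EFinD; congr (_%:E).
    by rewrite sqrrB; ring.
  - by move=> t _; rewrite lee_fin sqr_ge0.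
  - by apply/measurable_EFinP; exact: mE2.
  - by move=> t _; rewrite lee_fin sqr_ge0.
  - by apply/measurable_EFinP; exact: mE2.
  - by move=> t _; rewrite lee_fin sqr_ge0.
  - by apply/measurable_EFinP; apply: measurable_funX; exact: measurable_funB.
  - by move=> t _; rewrite adde_ge0.
  - exact: emeasurable_funD.
have := congr1 (fun z => z - ((e n x)%:E + (e n x)%:E)) H.
rewrite -!EFinD addeK// => ->.
by congr (_%:E); ring.
Qed.

Let e_nd n m x : (n <= m)%N -> (e n x <= e m x)%R.
Proof.
move=> nm; rewrite -subr_ge0 -lee_fin -cell_average_dist//.
by apply: integral_ge0 => t _; rewrite lee_fin sqr_ge0.
Qed.

(** Covers two fast indices without first settling which is larger. *)
Let dist_sym n m x :
  \int[mu x]_t ((E m x t - E n x t) ^+ 2)%:E = `|e m x - e n x|%:E.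
Proof.
have [nm|/ltnW mn] := leqP n m.
  by rewrite ger0_norm ?subr_ge0 ?e_nd// cell_average_dist.
rewrite distrC ger0_norm ?subr_ge0 ?e_nd// -cell_average_dist//.
by apply: eq_integral => t _; rewrite -sqrrN opprB.
Qed.

Let measurable_e n : measurable_fun setT (e n).
Proof.
apply: measurableT_comp => //.
have -> : (fun x => \int[mu x]_t (E n x t ^+ 2)%:E) =
    (fun x => \sum_(c <oo) ((ratio n c x ^+ 2)%:E * mu x [set t | cell n t = c])).
  apply/funext => x.
  rewrite (integral_count _ (measurable_cell n)
    (h := fun c => (ratio n c x ^+ 2)%:E))// => c.
  by rewrite lee_fin sqr_ge0.
apply: ge0_emeasurable_sum => [c x _ _|c _].
  by rewrite mule_ge0// lee_fin sqr_ge0.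
apply: emeasurable_funM; last exact/mmu/measurable_cell.
by apply/measurable_EFinP; apply: measurable_funX.
Qed.

(** The rate 4^-k still leaves the summable 2^-k after the factor 2^k by which the L1 bound is
    obtained. *)
Let eps k : R := (4 ^+ k)^-1%R.

(** Level [n] has almost exhausted the energy, so any later increment is small in L2. The clause
    [k <= n] makes the chosen levels tend to infinity, so that every fixed cell is eventually
    resolved. *)
Let good k x n : bool :=
  (k <= n)%N && `[< forall m, (e m x <= e n x + eps k)%R >].

Let good_ex k x : exists n, good k x n.
Proof.
have eps0 : (0 < eps k)%R by rewrite invr_gt0 exprn_gt0.
have hs : has_sup (range (e ^~ x)).
  split; first by exists (e 0%N x); exists 0%N.
  by exists (fine (mu x setT)) => _ [n _ <-].
have [_ [n _ <-] hn] := sup_adherent eps0 hs.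
exists (maxn k n); rewrite /good leq_maxl /=; apply/asboolP => m.
have em : (e m x <= sup (range (e ^~ x)))%R.
  by apply: sup_upper_bound => //; exists m.
have := e_nd x (leq_maxr k n); move: hn em; lra.
Qed.

(** Taking the least good level makes the choice measurable in [x]: its fibres are built from
    countably many comparisons of energies. *)
Definition fast_index k x : nat := ex_minn (good_ex k x).

Let fast_le k x : (k <= fast_index k x)%N.
Proof. by rewrite /fast_index; case: ex_minnP => n /andP[]. Qed.

Let fast_e k x m : (e m x <= e (fast_index k x) x + eps k)%R.
Proof.
by rewrite /fast_index; case: ex_minnP => n /andP[_ /asboolP /(_ m)].
Qed.

Let measurable_fast k n : measurable [set x | fast_index k x = n].
Proof.
have mg m : measurable [set x | good k x m].
  rewrite /good; case: (leqP k m) => km /=; last first.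
    by rewrite (_ : [set _ | _] = set0)//; apply/seteqP; split.
  rewrite (_ : [set _ | _] =
    \bigcap_j [set x | (e j x <= e m x + eps k)%R]).
    apply: bigcapT_measurable => j.
    rewrite -[X in measurable X]setTI; apply: measurable_fun_ler => //.
    exact: measurable_funD.
  apply/seteqP; split => x /= => [/asboolP h j _|h]; first exact: h.
  by apply/asboolP => j; exact: h.
rewrite (_ : [set _ | _] = [set x | good k x n] `\`
    \bigcup_(m in [set m | (m < n)%N]) [set x | good k x m]).
  by apply: measurableD => //; apply: bigcup_measurable => m _.
apply/seteqP; split => x /=.
  move=> <-; rewrite /fast_index; case: ex_minnP => i gi mi; split => // -[m /= mi' gm].
  by have := mi _ gm; rewrite leqNgt mi'.
move=> [gn h]; rewrite /fast_index; case: ex_minnP => i gi mi.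
apply/eqP; rewrite eqn_leq mi//= leqNgt; apply/negP => ni; apply: h.
by exists i.
Qed.

Let G k x t : R := E (fast_index k x) x t.

Let measurable_G k : measurable_fun setT (fun p : X * S => G k p.1 p.2).
Proof.
apply: (@measurable_fun_glue _ _ _ _ _ (fun p : X * S => fast_index k p.1)
  (fun n p => E n p.1 p.2)) => [n|n]; last exact: measurable_cell_average.
have := @measurable_fst _ _ X S measurableT _ (measurable_fast k n).
by rewrite setTI.
Qed.

Let measurable_G2 k x : measurable_fun setT (G k x).
Proof. exact: measurable_cell_average2. Qed.

Let G01 k x t : (0 <= G k x t <= 1)%R.
Proof. by rewrite /G cell_average_ge0 cell_average_le1. Qed.

Let M x : R := fine (mu x setT).

Let incr k x t : R := `|G k.+1 x t - G k x t|%R.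

Let measurable_incr k x : measurable_fun setT (incr k x).
Proof. by apply: measurableT_comp => //; exact: measurable_funB. Qed.

(* [d <= 2^k d^2 + 2^-k] turns the L2 bound on the increments into a summable L1 bound. *)
Let int_d k x :
  \int[mu x]_t (incr k x t)%:E <= ((2 * (1 + M x)) / (2 ^ k.+1)%:R)%:E.
Proof.
have a0 : (0 < 2 ^+ k :> R)%R by rewrite exprn_gt0.
have mD2 : measurable_fun setT (fun t => (G k.+1 x t - G k x t) ^+ 2)%R.
  by apply: measurable_funX; exact: measurable_funB.
have h : \int[mu x]_t ((G k.+1 x t - G k x t) ^+ 2)%:E <= (eps k)%:E.
  rewrite dist_sym lee_fin ler_norml.
  have := fast_e k x (fast_index k.+1 x).
  have := fast_e k.+1 x (fast_index k x).
  have : (eps k.+1 <= eps k)%R.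
    by rewrite lef_pV2 ?posrE ?exprn_gt0// exprS ler_peMl ?exprn_ge0// ler1n.
  by move=> e1 e2 e3; apply/andP; split; lra.
apply: (@le_trans _ _ (\int[mu x]_t ((2 ^+ k)%:E *
    ((G k.+1 x t - G k x t) ^+ 2)%:E + ((2 ^+ k)^-1)%:E))).
  apply: ge0_le_integral => //.
  - by move=> t _; rewrite lee_fin normr_ge0.
  - exact/measurable_EFinP.
  - apply: emeasurable_funD => //; apply: emeasurable_funM => //.
    exact/measurable_EFinP.
  - move=> t _; rewrite -EFinM -EFinD lee_fin /incr -(real_normK (num_real (_ - _))).
    set z := `|_|%R; rewrite -subr_ge0.
    (* Completing the square in [2^k z] exhibits the difference as nonnegative. *)
    have -> : (2 ^+ k * z ^+ 2 + (2 ^+ k)^-1 - z =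
        (2 ^+ k)^-1 * ((2 ^+ k * z - 1 / 2) ^+ 2 + 3 / 4))%R.
      by field; rewrite gt_eqF.
    by rewrite mulr_ge0// ?invr_ge0 ?(ltW a0)// addr_ge0 ?sqr_ge0// divr_ge0.
rewrite ge0_integralD//; last 2 first.
- by move=> t _; rewrite -EFinM lee_fin mulr_ge0 ?sqr_ge0// ltW.
- by apply: emeasurable_funM => //; exact/measurable_EFinP.
rewrite ge0_integralZl//; last 2 first.
- exact/measurable_EFinP.
- by move=> t _; rewrite lee_fin sqr_ge0.
rewrite integral_cst//.
apply: (@le_trans _ _ ((2 ^+ k)%:E * (eps k)%:E + ((2 ^+ k)^-1)%:E * (M x)%:E)).
  rewrite leeD// ?lee_wpmul2l ?lee_fin ?(ltW a0)//.
  by rewrite fineK// mufin.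
(* The two terms add up to [(1 + M x) / 2^k], written over [2^(k+1)] because [epsilon_trick0] sums
   bounds of that shape. *)
rewrite -!EFinM -EFinD lee_fin natrX exprS.
have -> : eps k = ((2 ^+ k)^-1 * (2 ^+ k)^-1)%R.
  by rewrite /eps -invfM -exprMn; congr ((_ ^+ _)^-1)%R; rewrite -natrM.
rewrite le_eqVlt; apply/orP; left; apply/eqP; field.
by rewrite gt_eqF.
Qed.

(** The sum of the absolute increments is integrable, hence finite almost everywhere, and there the
    telescoping series converges absolutely. *)
Let G_cvg x : {ae mu x, forall t, cvgn (fun k => G k x t)}.
Proof.
pose f t := \sum_(k <oo) (incr k x t)%:E.
have f0 t : 0 <= f t by apply: nneseries_ge0 => k _ _; rewrite lee_fin normr_ge0.
have mf : measurable_fun setT f.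
  apply: ge0_emeasurable_sum => [k t _ _|k _]; first by rewrite lee_fin normr_ge0.
  exact/measurable_EFinP.
have fi : (mu x).-integrable setT f.
  apply/integrableP; split => //.
  under eq_integral do rewrite gee0_abs//.
  rewrite integral_nneseries//; last 2 first.
  - by move=> k; exact/measurable_EFinP.
  - by move=> k t _; rewrite lee_fin normr_ge0.
  have M0 : (0 <= 2 * (1 + M x))%R by rewrite mulr_ge0// addr_ge0// fine_ge0.
  apply: le_lt_trans (le_trans _ (epsilon_trick0 xpredT M0)) (ltry _).
  apply: lee_nneseries => k _; last exact: int_d.
  by move=> _; apply: integral_ge0 => t _; rewrite lee_fin normr_ge0.
have := integrable_ae measurableT fi; apply: filterS => t /(_ I) ft.
pose u k := (G k.+1 x t - G k x t)%R.
have uc : cvgn (series u).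
  apply: normed_cvg; apply: nondecreasing_is_cvgn.
    apply/nondecreasing_seqP => n.
    by rewrite /= /series /= big_nat_recr//= lerDl.
  exists (fine (f t)) => _ [n _ <-]; rewrite /series /= -lee_fin fineK//.
  rewrite -sumEFin; apply: nneseries_lim_ge => k _.
  by rewrite lee_fin normr_ge0.
have GE : (fun k => G k x t) = (fun k => G 0%N x t + series u k)%R.
  apply/funext => n; rewrite /series /= telescope_sumr//.
  by rewrite addrC subrK.
rewrite GE; apply: is_cvgD => //; exact: is_cvg_cst.
Qed.

(** The upper limit exists everywhere, is jointly measurable, and agrees with the limit where there
    is one. *)
Let F x t : \bar R := limn_esup (fun k => (G k x t)%:E).

Let F01 x t : 0 <= F x t <= 1.
Proof.
rewrite /F limn_esup_lim; apply/andP; split.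
  apply: lime_ge; first exact: is_cvg_esups.
  apply: nearW => n; apply: (@le_trans _ _ (G n x t)%:E).
    by rewrite lee_fin; case/andP: (G01 n x t).
  by apply: ereal_sup_ubound; exists n => //=.
apply: lime_le; first exact: is_cvg_esups.
apply: nearW => n; apply: ge_ereal_sup => _ [m _ <-].
by rewrite lee_fin; case/andP: (G01 m x t).
Qed.

Let Ffin x t : F x t = (fine (F x t))%:E.
Proof.
rewrite fineK// ge0_fin_numE; last by case/andP: (F01 x t).
by case/andP: (F01 x t) => _ F1; exact: le_lt_trans F1 (ltry _).
Qed.

Let measurable_F : measurable_fun setT (fun p : X * S => F p.1 p.2).
Proof.
apply: (measurable_fun_limn_esup (f := fun k p => (G k p.1 p.2)%:E)) => k.
exact/measurable_EFinP.
Qed.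

Let measurable_F2 x : measurable_fun setT (F x).
Proof.
apply: (measurable_fun_limn_esup (f := fun k t => (G k x t)%:E)) => k.
exact/measurable_EFinP.
Qed.

Let int_F_cell x n (B : set nat) :
  \int[mu x]_(t in cell n @^-1` B) F x t = nu x (cell n @^-1` B).
Proof.
have mB := measurable_cellB n B.
have [] := @dominated_convergence _ _ _ (mu x) _ mB
  (fun k t => (G k x t)%:E) (F x) (cst 1).
- by move=> k; apply/measurable_EFinP; exact: measurable_funTS.
- exact: measurable_funTS.
- have := G_cvg x; apply: filterS => t Gc _.
  have Gc' : cvgn (fun k => (G k x t)%:E).
    by apply/cvg_ex; exists (limn (fun k => G k x t))%:E; exact: cvg_EFin (nearW _ _) Gc.
  by rewrite /F is_cvg_limn_esupE.
- apply/integrableP; split => //.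
  under eq_integral do rewrite gee0_abs//.
  by rewrite integral_cst// mul1e muoo'.
- apply: aeW => t k _; have /andP[? ?] := G01 k x t.
  by rewrite gee0_abs ?lee_fin.
move=> _ _ h; rewrite -(cvg_lim _ h)//.
(* From [k = n] on, the fast level refines level [n], so the integrals over this set are not merely
   convergent but constant. *)
apply/cvg_lim => //; apply: cvg_near_cst; exists n => // k /= nk.
set N := fast_index k x.
have [q qE] := cell_coarsen (leq_trans nk (fast_le k x)).
have -> : nu x (cell n @^-1` B) = \int[nu x]_t (\1_(cell n @^-1` B) t)%:E.
  by rewrite integral_indic// setIT.
rewrite -[in LHS](setTI (cell n @^-1` B)) integral_mkcondr.
transitivity (\int[mu x]_t (E N x t * \1_B (q (cell N t)))%:E).
  apply: eq_integral => t _; rewrite patchE /G -/N -qE.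
  have -> : (t \in cell n @^-1` B) = (cell n t \in B).
    by apply/idP/idP; rewrite !inE.
  by rewrite indicE; case: ifP => _; rewrite ?mulr1 ?mulr0.
rewrite (integral_cell_average N x (b := fun c => \1_B (q c)))//.
apply: eq_integral => t _; rewrite -qE !indicE.
by congr ((_ : bool)%:R%:E); apply/idP/idP; rewrite !inE /=.
Qed.

Lemma kernel_Radon_Nikodym : exists p : X -> S -> R,
  [/\ measurable_fun setT (fun q : X * S => p q.1 q.2),
      forall x t, (0 <= p x t <= 1)%R &
      forall x (b : S -> \bar R), (forall t, 0 <= b t) -> measurable_fun setT b ->
        \int[mu x]_t ((p x t)%:E * b t) = \int[nu x]_t b t].
Proof.
exists (fun x t => fine (F x t)); split.
- exact: measurableT_comp.
- by move=> x t; rewrite -!lee_fin -Ffin; exact: F01.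
move=> x b b0 mb.
have p0 t : (0 <= fine (F x t))%R by rewrite fine_ge0//; case/andP: (F01 x t).
have mp : measurable_fun setT (fun t => fine (F x t)) by exact: measurableT_comp.
rewrite -(@integral_density_pushforward _ _ _ _ _ (mu x) _ id p0 mp _ b)//.
apply: eq_measure_integral => A mA _.
(* Unions of cells form a generating class stable under intersection, since two levels have a common
   refinement; two finite measures that agree on it coincide. *)
pose Gen := [set A | exists n B, A = cell n @^-1` B].
apply: (@measure_unique _ _ _ Gen (fun _ => setT)) => //.
- apply/seteqP; split.
    apply: subset_trans genC _; apply: smallest_sub.
      exact: smallest_sigma_algebra.
    move=> _ [j _ <-]; apply: sub_sigma_algebra.
    (* Membership in [C j] is the lowest digit at level [j + 1]. *)
    exists j.+1, [set c | odd c].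
    apply/seteqP; split => t /=.
      by move=> Ct; rewrite mem_set// oddD odd_double.
    by case: (boolP (t \in C j)) => [/set_mem//|_]; rewrite oddD odd_double.
  apply: smallest_sub; first exact: sigma_algebra_measurable.
  by move=> _ [n [B ->]]; exact: measurable_cellB.
- move=> _ _ [n [B ->]] [m [B' ->]].
  have [q qE] := cell_coarsen (leq_maxl n m).
  have [q' qE'] := cell_coarsen (leq_maxr n m).
  exists (maxn n m), (q @^-1` B `&` q' @^-1` B').
  by apply/seteqP; split => t /=; rewrite -qE -qE'.
- by move=> _; exists 0%N, setT.
- by rewrite bigcup_const//; exists 0%N.
- move=> _ [n [B ->]]; rewrite -int_F_cell /density_pushforward.
  rewrite -[in RHS](setTI (cell n @^-1` B)) integral_mkcondr.
  apply: eq_integral => t _; rewrite patchE indicE -Ffin.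
  by case: ifP => _; rewrite ?mule1 ?mule0.
- move=> _; apply: le_lt_trans (muoo x); rewrite /= /density_pushforward.
  rewrite -[leRHS]mul1e -(integral_cst _ measurableT).
  apply: ge0_le_integral => //.
  + by move=> t _; rewrite mule_ge0// lee_fin.
  + apply: emeasurable_funM; apply/measurable_EFinP => //.
  + by move=> t _; rewrite indicT mule1 -Ffin; case/andP: (F01 x t).
Qed.

End kernel_Radon_Nikodym.

(** * Borel coding of a locally compact second countable space *)

(* A word lists the first coordinates of a point of the Cantor space in reverse
   order, so that its head is the last coordinate read. *)
Fixpoint word (n : nat) (x : nat -> bool) : seq bool :=
  if n is n'.+1 then x n' :: word n' x else [::].

Lemma size_word n x : size (word n x) = n.
Proof. by elim: n => //= n ->. Qed.

Lemma drop_word n m x : drop n (word (n + m) x) = word m x.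
Proof. by elim: n => [|n IH] //=; rewrite drop0. Qed.

Definition cylinder (s : seq bool) : set (nat -> bool) :=
  [set x | word (size s) x = s].

(** The empty set is included because incompatible words give disjoint cylinders; with it the class
    is stable under intersection, as uniqueness of measures requires. *)
Definition cylinders : set (set (nat -> bool)) :=
  [set A | A = set0 \/ exists s, A = cylinder s].

Notation cantor_borel := (g_sigma_algebraType cylinders).

Lemma setI_closed_cylinders : setI_closed cylinders.
Proof.
have H s s' : (size s <= size s')%N -> cylinders (cylinder s `&` cylinder s').
  move=> /subnK E; have [ds|ds] := eqVneq (drop (size s' - size s) s') s.
    right; exists s'; apply/seteqP; split => x; first by case.
    move=> xs'; split => //; have := drop_word (size s' - size s) (size s) x.
    by rewrite E (xs' : word _ _ = _) ds /cylinder /= => <-.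
  left; rewrite -subset0 => x [xs xs']; move/eqP: ds; apply.
  have := drop_word (size s' - size s) (size s) x.
  by rewrite E (xs' : word _ _ = _) (xs : word _ _ = _).
move=> A B [->|[s ->]]; first by move=> _; rewrite set0I; left.
move=> [->|[s' ->]]; first by rewrite setI0; left.
have [/H//|/ltnW/H] := leqP (size s) (size s').
by rewrite setIC.
Qed.

Lemma cylinder_nil : cylinder [::] = setT.
Proof. by apply/seteqP; split. Qed.

Lemma cylinder_cons b s :
  cylinder (b :: s) = cylinder s `&` [set x | x (size s) = b].
Proof.
by apply/seteqP; split => x /=; rewrite /cylinder /= => -[]; [move=> -> ->|move=> -> ->].
Qed.

Lemma measurable_cylinder s : measurable (cylinder s : set cantor_borel).
Proof. by apply: sub_sigma_algebra; right; exists s. Qed.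

Lemma measurable_coordinate n : measurable [set x : cantor_borel | x n].
Proof.
rewrite (_ : [set x : cantor_borel | x n] =
    \bigcup_(s in [set s | size s = n]) cylinder (true :: s)).
  rewrite bigcup_mkcond; apply: countable_bigcupT_measurable => // s.
  by case: ifP => // _; exact: measurable_cylinder.
apply/seteqP; split => x /=.
  move=> xn; exists (word n x) => /=; first by rewrite size_word.
  by rewrite /cylinder /= size_word xn.
by move=> [s /= <-]; rewrite cylinder_cons => -[_ /= ->].
Qed.

Lemma measurable_to_cantor d (T : measurableType d) (f : T -> cantor_borel) :
  (forall n, measurable [set t | f t n]) -> measurable_fun setT f.
Proof.
move=> mf; apply: (@measurability _ _ T cantor_borel setT f cylinders erefl).
move=> _ [_ [->|[s ->]] <-]; first by rewrite preimage_set0 setI0.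
rewrite setTI; elim: s => [|b s IH]; first by rewrite cylinder_nil preimage_setT.
rewrite cylinder_cons preimage_setI; apply: measurableI => //.
case: b; first exact: mf.
rewrite (_ : _ @^-1` _ = ~` [set t | f t (size s)]); first exact/measurableC/mf.
by apply/seteqP; split => t /=; case: (f t _).
Qed.

(** * A countable base as a Borel embedding with Borel inverse *)

Section lcsc_coding.
Context (G : ptopologicalType).
Hypotheses (hG : hausdorff_space G) (lG : locally_compact [set: G])
  (sG : @second_countable G).

Lemma second_countable_seq : exists U : nat -> set G,
  (forall n, open (U n)) /\
  (forall (g : G) A, nbhs g A -> exists n, U n g /\ U n `<=` A).
Proof.
have [B /countable_injP[f] fB [Bo Bb]] := sG.
(* Indices not attained by [f] yield the empty set, which is open and harmless. *)
exists (fun n => [set g | exists A, [/\ B A, f A = n & A g]]); split.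
  move=> n; rewrite (_ : [set g | _] = \bigcup_(A in [set A | B A /\ f A = n]) A).
    by apply: bigcup_open => A [/Bo].
  apply/seteqP; split => g /= [A].
    by move=> [BA fA Ag]; exists A.
  by move=> [BA fA] Ag; exists A.
move=> g A /Bb[V [BV Vg] VA]; exists (f V); split; first by exists V.
move=> h [W [BW fW Wh]]; apply: VA.
by rewrite -(fB W V)// ?inE.
Qed.

Variable U : nat -> set G.
Hypotheses (oU : forall n, open (U n))
  (bU : forall (g : G) A, nbhs g A -> exists n, U n g /\ U n `<=` A).

Definition code (g : borel G) : cantor_borel := fun n => `[< U n g >].

Let local_compact (g : G) : exists2 V, nbhs g V & compact V.
Proof.
have [V gV [cV _]] := lG (I : [set: G] g); exists V => //.
rewrite (_ : V = [set y | [set: G] y -> V y]); first exact: gV.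
by apply/seteqP; split => y //=; apply.
Qed.

Let regular (g : G) n : U n g -> exists m, U m g /\ closure (U m) `<=` U n.
Proof.
move=> Ug; have [V gV cV] := local_compact g.
have /= := compact_regular hG cV gV.
move=> /(_ (U n)) []; first by apply: open_nbhs_nbhs; split.
move=> W gW WU; have [m [Umg UW]] := bU gW.
by exists m; split => //; apply: subset_trans WU; exact: closureS.
Qed.

(* Points of the Cantor space that code the base filter of a point: nonempty,
   with a relatively compact member, regularly directed, and maximal. *)
Let is_code (x : cantor_borel) : Prop :=
  [/\ forall n, x n -> U n !=set0,
      exists n, x n /\ compact (closure (U n)),
      forall n m, x n -> x m ->
        exists k, x k /\ closure (U k) `<=` U n `&` U m &
      forall n m, closure (U m) `<=` U n ->
        x n \/ exists k, x k /\ U k `&` U m = set0].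

(** This shows the range of [code] to be Borel without a theorem on injective Borel images. The sets
    selected by [x] generate a filter; compactness gives it a cluster point [g], directedness puts
    [g] in each selected set, and maximality forces every basic set around [g] to be selected. *)
Let is_codeP x : is_code x <-> exists g, x = code g.
Proof.
split=> [[ne [n0 [xn0 cn0]] dir mx]|[g ->]].
  pose F := filter_from [set n | x n] U.
  have FF : ProperFilter F.
    apply: filter_from_proper; last by move=> n /ne.
    apply: filter_from_filter; first by exists n0.
    move=> i j xi xj; have [k [xk kij]] := dir _ _ xi xj.
    by exists k => //; apply: subset_trans kij; exact: subset_closure.
  have Fc : F (closure (U n0)) by exists n0 => //; exact: subset_closure.
  have [g [_ Fg]] := cn0 F FF Fc.
  exists g; apply/funext => n; apply/idP/asboolP => [xn|Ung].
    have [k [xk kn]] := dir _ _ xn xn.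
    have [] // := kn g.
    by move: Fg; rewrite clusterE; apply; exists k.
  have [m [Umg mn]] := regular Ung.
  case: (mx _ _ mn) => // -[k [xk km0]].
  have : closure (U k) g by move: Fg; rewrite clusterE; apply; exists k.
  move=> /(_ (U m)); rewrite km0 => -[]//.
  by apply: open_nbhs_nbhs; split.
split.
- by move=> n /asboolP Ung; exists g.
- have [V gV cV] := local_compact g.
  have [n [Ung UV]] := bU gV.
  exists n; split; first exact/asboolP.
  apply: (subclosed_compact _ cV); first exact: closed_closure.
  have /closure_id -> : closed V by exact: compact_closed.
  exact: closureS.
- move=> n m /asboolP Ung /asboolP Umg.
  have [n' [n'g n'n]] := regular Ung.
  have [m' [m'g m'm]] := regular Umg.
  have [|k [kg knm]] := @bU g (U n' `&` U m').
    by apply: filterI; apply: open_nbhs_nbhs; split.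
  exists k; split; first exact/asboolP.
  move=> h hk; split.
    by apply: n'n; apply: closureS hk => z /knm[].
  by apply: m'm; apply: closureS hk => z /knm[].
- move=> n m mn; have [Ung|Ung] := pselect (U n g); first by left; exact/asboolP.
  right; have : nbhs g (~` closure (U m)).
    apply: open_nbhs_nbhs; split.
      by apply: closed_openC; exact: closed_closure.
    by move=> /mn.
  move=> /bU[k [kg km]]; exists k; split; first exact/asboolP.
  rewrite -subset0 => z [/km + zm]; apply.
  exact: subset_closure.
Qed.

Let measurable_is_code : measurable [set x | is_code x].
Proof.
have mall (P : nat -> cantor_borel -> Prop) :
    (forall n, measurable [set x | P n x]) -> measurable [set x | forall n, P n x].
  move=> mP; rewrite (_ : [set x | _] = \bigcap_n [set x | P n x]).
    exact: bigcapT_measurable.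
  by apply/seteqP; split => x /= h n => [_|]; exact: h.
have mex (P : nat -> cantor_borel -> Prop) :
    (forall n, measurable [set x | P n x]) -> measurable [set x | exists n, P n x].
  move=> mP; rewrite (_ : [set x | _] = \bigcup_n [set x | P n x]).
    exact: bigcupT_measurable.
  by apply/seteqP; split => x /= [n]; exists n.
have mcst (Q : Prop) : measurable [set x : cantor_borel | Q].
  have [q|q] := pselect Q.
    by rewrite (_ : [set _ | _] = setT)//; apply/seteqP; split.
  by rewrite (_ : [set _ | _] = set0)//; apply/seteqP; split.
have mand (P Q : cantor_borel -> Prop) : measurable [set x | P x] ->
    measurable [set x | Q x] -> measurable [set x | P x /\ Q x].
  by move=> mP mQ; exact: (measurableI _ _ mP mQ).
have mor (P Q : cantor_borel -> Prop) : measurable [set x | P x] ->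
    measurable [set x | Q x] -> measurable [set x | P x \/ Q x].
  by move=> mP mQ; exact: (measurableU _ _ mP mQ).
have mimp (P Q : cantor_borel -> Prop) : measurable [set x | P x] ->
    measurable [set x | Q x] -> measurable [set x | P x -> Q x].
  move=> mP mQ; rewrite (_ : [set x | _] = ~` [set x | P x] `|` [set x | Q x]).
    by apply: measurableU => //; exact: measurableC.
  apply/seteqP; split => x /=; last by case.
  by move=> h; have [/h|] := pselect (P x); [right|left].
have mx := measurable_coordinate.
rewrite (_ : [set x : cantor_borel | is_code x] =
  [set x : cantor_borel | forall n, x n -> U n !=set0] `&`
  [set x : cantor_borel | exists n, x n /\ compact (closure (U n))] `&`
  [set x : cantor_borel | forall n m, x n -> x m ->
        exists k, x k /\ closure (U k) `<=` U n `&` U m] `&`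
  [set x : cantor_borel | forall n m, closure (U m) `<=` U n ->
        x n \/ exists k, x k /\ U k `&` U m = set0]); last first.
  by apply/seteqP; split => x /=; [case|move=> [[[]]]].
apply: measurableI; first (apply: measurableI; first apply: measurableI).
- by apply: (mall) => n; exact: mimp.
- by apply: (mex) => n; apply: (mand).
- apply: (mall) => n; apply: (mall) => m; apply: (mimp) => //; apply: (mimp) => //.
  by apply: (mex) => k; exact: mand.
- apply: (mall) => n; apply: (mall) => m; apply: (mimp) => //.
  by apply: (mor) => //; apply: (mex) => k; exact: mand.
Qed.

Lemma measurable_to_borel d (T : measurableType d) (f : T -> borel G) :
  (forall n, measurable (f @^-1` U n)) -> measurable_fun setT f.
Proof.
move=> mf; apply: (@measurability _ _ T (borel G) setT f (@open G) erefl).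
move=> _ [A oA <-]; rewrite setTI.
rewrite (_ : f @^-1` A = \bigcup_(n in [set n | U n `<=` A]) (f @^-1` U n)).
  by rewrite bigcup_mkcond; apply: bigcupT_measurable => n; case: ifP.
apply/seteqP; split => [t /= At|t [n /= nA Un]]; last exact: nA.
have /bU[n [Un nA]] : nbhs (f t) A by apply: open_nbhs_nbhs; split.
by exists n.
Qed.

Lemma measurable_code : measurable_fun setT code.
Proof.
apply: measurable_to_cantor => n.
rewrite (_ : [set t | _] = U n); first exact: sub_sigma_algebra.
by apply/seteqP; split => g /asboolP.
Qed.

Lemma code_inj : injective code.
Proof.
move=> g h gh; apply: hG => A B gA hB.
have [n [ng nA]] := bU gA.
have : code h n by rewrite -gh; exact/asboolP.
by move=> /asboolP nh; exists h; split; [exact: nA|exact: nbhs_singleton].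
Qed.

Definition decode (x : cantor_borel) : borel G := xget point [set g | code g = x].

Lemma decodeK : cancel code decode.
Proof.
move=> g; apply: code_inj; rewrite /decode.
by case: xgetP => [h _ hg//|/(_ g)/(_ erefl)].
Qed.

Lemma measurable_decode : measurable_fun setT decode.
Proof.
apply: measurable_to_borel => n.
(* On codes, [decode] lies in [U n] exactly when the [n]-th digit is set; elsewhere it is the
   default [point]. *)
rewrite (_ : decode @^-1` U n =
    [set x : cantor_borel | is_code x] `&` [set x : cantor_borel | x n] `|`
    [set x : cantor_borel | ~ is_code x /\ U n point]).
  apply: measurableU; first exact: measurableI (measurable_coordinate n).
  have [Up|Up] := pselect (U n point).
    rewrite (_ : [set x : cantor_borel | _] = ~` [set x : cantor_borel | is_code x]).
      exact: measurableC.
    by apply/seteqP; split => x /= => [[]|].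
  rewrite (_ : [set x : cantor_borel | _] = set0)//.
  by apply/seteqP; split => x /= => [[]|].
apply/seteqP; split => x /=.
  have [/[dup] cx /is_codeP[g ->]|cx] := pselect (is_code x).
    by rewrite decodeK => Ug; left; split; [apply/is_codeP; exists g|exact/asboolP].
  rewrite /decode; case: xgetP => [g _ xg _|_ Up]; last by right.
  by exfalso; apply: cx; apply/is_codeP; exists g.
move=> [[/is_codeP[g ->] /asboolP Ug]|[cx Up]]; first by rewrite decodeK.
rewrite /decode; case: xgetP => [g _ xg|//].
by exfalso; apply: cx; apply/is_codeP; exists g.
Qed.

End lcsc_coding.

(** * Disintegration by random digits *)

(** Gives the digit [false] its conditional probability by subtraction, which finite mass and
    bounded [b] make legitimate. *)
Lemma integral_complement d (S : measurableType d) (R : realType)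
    (m m1 m2 : {measure set S -> \bar R}) (p b : S -> R) :
  (forall t, (0 <= p t <= 1)%R) -> measurable_fun setT p ->
  (forall t, (0 <= b t <= 1)%R) -> measurable_fun setT b ->
  m setT < +oo ->
  \int[m]_t (b t)%:E = \int[m1]_t (b t)%:E + \int[m2]_t (b t)%:E ->
  \int[m]_t (p t * b t)%:E = \int[m1]_t (b t)%:E ->
  \int[m]_t ((1 - p t) * b t)%:E = \int[m2]_t (b t)%:E.
Proof.
move=> p01 mp b01 mb moo mE pE.
have pb01 t : (0 <= p t * b t <= 1)%R.
  have /andP[? ?] := p01 t; have /andP[? ?] := b01 t.
  by rewrite mulr_ge0//= mulr_ile1.
have fpb : \int[m]_t (p t * b t)%:E \is a fin_num.
  rewrite ge0_fin_numE; last first.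
    by apply: integral_ge0 => t _; rewrite lee_fin; case/andP: (pb01 t).
  apply: le_lt_trans moo; rewrite -[leRHS]mul1e -(integral_cst _ measurableT).
  apply: ge0_le_integral => //.
  - by move=> t _; rewrite lee_fin; case/andP: (pb01 t).
  - by apply/measurable_EFinP; exact: measurable_funM.
  - by move=> t _; rewrite lee_fin; case/andP: (pb01 t).
have : \int[m]_t ((1 - p t) * b t)%:E + \int[m]_t (p t * b t)%:E
    = \int[m]_t (b t)%:E.
  rewrite -ge0_integralD//.
  - by apply: eq_integral => t _; rewrite -EFinD; congr (_%:E); ring.
  - move=> t _; rewrite lee_fin mulr_ge0//; last by case/andP: (b01 t).
    by rewrite subr_ge0; case/andP: (p01 t).
  - apply/measurable_EFinP; apply: measurable_funM => //.
    exact: measurable_funB.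
  - by move=> t _; rewrite lee_fin; case/andP: (pb01 t).
  - by apply/measurable_EFinP; exact: measurable_funM.
rewrite mE -pE => /(congr1 (fun z => z - \int[m]_t (p t * b t)%:E)).
by rewrite addeK// [in RHS]addeC addeK.
Qed.

Section kernel_disintegration.
Context dX dS dH (X : measurableType dX) (S : measurableType dS)
  (H : measurableType dH) (R : realType).
Variables (lam : {sigma_finite_measure set H -> \bar R})
  (w : X -> H -> R) (q : X -> H -> S) (C : nat -> set S)
  (c : H -> cantor_borel) (dc : cantor_borel -> H).
Hypotheses
  (w0 : forall x g, (0 <= w x g)%R)
  (mw : measurable_fun setT (fun p : X * H => w p.1 p.2))
  (woo : forall x, \int[lam]_g (w x g)%:E < +oo)
  (mq : measurable_fun setT (fun p : X * H => q p.1 p.2))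
  (mC : forall n, measurable (C n))
  (genC : @measurable _ S `<=` <<s range C>>)
  (mc : measurable_fun setT c) (mdc : measurable_fun setT dc)
  (cK : cancel c dc).

Let mwx x : measurable_fun setT (w x).
Proof. exact: (measurableT_comp mw (measurable_pair1 x)). Qed.

Let mqx x : measurable_fun setT (q x).
Proof. exact: (measurableT_comp mq (measurable_pair1 x)). Qed.

Let A (s : seq bool) : set H := c @^-1` cylinder s.

Let mA s : measurable (A s).
Proof. by rewrite -[A s]setTI; exact: mc (measurable_cylinder s). Qed.

Let A_nil : A [::] = setT.
Proof. by rewrite /A cylinder_nil preimage_setT. Qed.

Let A_split s g : (\1_(A (true :: s)) g + \1_(A (false :: s)) g = \1_(A s) g :> R)%R.
Proof.
rewrite !indicE.
have E b : (g \in A (b :: s)) = (g \in A s) && (c g (size s) == b).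
  apply/idP/andP; rewrite /A cylinder_cons !inE /=.
    by move=> [? ->].
  by move=> [? /eqP ->].
by rewrite !E; case: (_ \in _); case: (c g _); rewrite ?addr0 ?add0r.
Qed.

Let wA s x g : R := (w x g * \1_(A s) g)%R.

Let wA0 s x g : (0 <= wA s x g)%R.
Proof. by rewrite mulr_ge0. Qed.

Let mwA s x : measurable_fun setT (wA s x).
Proof. by apply: measurable_funM => //; exact: measurable_indic. Qed.

(** The unnormalised law of [q x] on the event that the code starts with [s], kept behind an
    existential so that only its two descriptions are visible. *)
Let ms_ex s x : {m : {measure set S -> \bar R} |
  (forall B, m B = \int[lam]_g ((wA s x g)%:E * (\1_B (q x g))%:E)) /\
  (forall b, (forall t, 0 <= b t) -> measurable_fun setT b ->
    \int[m]_t b t = \int[lam]_g ((wA s x g)%:E * b (q x g)))}.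
Proof.
exists (mdensity_pushforward lam (wA0 s x) (mwA s x) (mqx x)); split => //.
by move=> b b0 mb; exact: integral_density_pushforward.
Qed.

Let ms s x : {measure set S -> \bar R} := sval (ms_ex s x).

Let msE s x B : ms s x B = \int[lam]_g ((wA s x g)%:E * (\1_B (q x g))%:E).
Proof. by rewrite /ms; case: (ms_ex s x) => m []. Qed.

Let ms_int s x (b : S -> \bar R) : (forall t, 0 <= b t) -> measurable_fun setT b ->
  \int[ms s x]_t b t = \int[lam]_g ((wA s x g)%:E * b (q x g)).
Proof. have [_ h] := svalP (ms_ex s x); exact: h. Qed.

Let measurable_ms s B : measurable B -> measurable_fun setT (fun x => ms s x B).
Proof.
move=> mB; under eq_fun do rewrite msE.
apply: (@measurable_fun_fubini_tonelli_F _ _ _ _ _ lam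
  (fun p : X * H => (wA s p.1 p.2)%:E * (\1_B (q p.1 p.2))%:E)).
  apply: emeasurable_funM; apply/measurable_EFinP.
    apply: measurable_funM => //.
    by apply: measurable_indic_comp => //; exact: measurable_snd.
  exact: measurable_indic_comp.
by move=> p; rewrite mule_ge0// lee_fin.
Qed.

Let ms_le s x B : measurable B -> ms (true :: s) x B <= ms s x B.
Proof.
move=> mB; rewrite !msE.
have mi s' : measurable_fun setT
    (fun g => (wA s' x g)%:E * (\1_B (q x g))%:E : \bar R).
  apply: emeasurable_funM; apply/measurable_EFinP => //.
  exact: measurable_indic_comp.
apply: ge0_le_integral => //.
- by move=> g _; rewrite mule_ge0// lee_fin.
- move=> g _; rewrite lee_wpmul2r// ?lee_fin// /wA ler_wpM2l//.
  by rewrite -(A_split s g) lerDl.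
Qed.

Let ms_oo s x : ms s x setT < +oo.
Proof.
apply: le_lt_trans (woo x); rewrite msE.
apply: ge0_le_integral => //.
- by move=> g _; rewrite mule_ge0// lee_fin.
- apply: emeasurable_funM; apply/measurable_EFinP => //.
  exact: measurable_indic_comp.
- exact/measurable_EFinP.
- move=> g _; rewrite indicT mule1 lee_fin /wA -[leRHS]mulr1 ler_wpM2l//;
    rewrite indicE lern1 leq_b1.
Qed.

Let branching s : {p : X -> S -> R |
  [/\ measurable_fun setT (fun z : X * S => p z.1 z.2),
      forall x t, (0 <= p x t <= 1)%R &
      forall x (b : S -> \bar R), (forall t, 0 <= b t) -> measurable_fun setT b ->
        \int[ms s x]_t ((p x t)%:E * b t) = \int[ms (true :: s) x]_t b t]}.
Proof.
apply: cid; exact: (kernel_Radon_Nikodym (measurable_ms s)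
  (measurable_ms (true :: s)) (ms_le s) (ms_oo s) mC genC).
Qed.

(* [p s x t] is the conditional probability that the digit following [s] is [true],
   given the prefix [s] and [q x = t]. *)
Let p s : X -> S -> R := sval (branching s).

Let mp s : measurable_fun setT (fun z : X * S => p s z.1 z.2).
Proof. by rewrite /p; case: (branching s) => ? []. Qed.

Let mpx s x : measurable_fun setT (p s x).
Proof. exact: (measurableT_comp (mp s) (measurable_pair1 x)). Qed.

Let p01 s x t : (0 <= p s x t <= 1)%R.
Proof. by rewrite /p; case: (branching s) => ? []. Qed.

Let p_int s x (b : S -> \bar R) : (forall t, 0 <= b t) -> measurable_fun setT b ->
  \int[ms s x]_t ((p s x t)%:E * b t) = \int[ms (true :: s) x]_t b t.
Proof. by rewrite /p; case: (branching s) => ? [? ? h] /=; exact: h. Qed.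

(** The chain rule: a product of digit probabilities, thus the conditional probability of the prefix
    [s] given [q x = t]. *)
Fixpoint branch_length (s : seq bool) x t : R :=
  if s is b :: s' then
    (branch_length s' x t * (if b then p s' x t else 1 - p s' x t))%R
  else 1%R.

Local Notation len := branch_length.

(** Left ends of nested intervals that subdivide [0, 1), with [false] to the left of [true]. The
    digits of a random point record the intervals into which the seed [u] falls. *)
Fixpoint branch_start (s : seq bool) x t : R :=
  match s with
  | [::] => 0%R
  | false :: s' => branch_start s' x t
  | true :: s' => (branch_start s' x t + len (false :: s') x t)%R
  end.

Local Notation lo := branch_start.

Let len_ge0 s x t : (0 <= len s x t)%R.
Proof.
elim: s => [|b s IH] //=; rewrite mulr_ge0//; have := p01 s x t.
by case: b => /andP[]//; rewrite subr_ge0.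
Qed.

Let len_split s x t : (len (true :: s) x t + len (false :: s) x t = len s x t)%R.
Proof. by rewrite /=; ring. Qed.

Let measurable_len s : measurable_fun setT (fun z : X * S => len s z.1 z.2).
Proof.
elim: s => [|b s IH] //=; apply: measurable_funM => //.
by case: b; [exact: mp|apply: measurable_funB => //; exact: mp].
Qed.

Let measurable_lo s : measurable_fun setT (fun z : X * S => lo s z.1 z.2).
Proof.
elim: s => [|[] s IH] //; apply: measurable_funD => //.
Qed.

Let lo_len s x t : (0 <= lo s x t)%R /\ (lo s x t + len s x t <= 1)%R.
Proof.
elim: s => [|b s [IH1 IH2]]; first by rewrite /= add0r.
have := len_split s x t; have := len_ge0 (true :: s) x t.
have := len_ge0 (false :: s) x t.
case: b; rewrite [lo _ _ _]/= -?[(len s x t * (1 - p s x t))%R]/(len (false :: s) x t);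
  by split; lra.
Qed.

Let ms_split s x (b : S -> R) : (forall t, (0 <= b t)%R) ->
  measurable_fun setT b -> \int[ms s x]_t (b t)%:E =
  \int[ms (true :: s) x]_t (b t)%:E + \int[ms (false :: s) x]_t (b t)%:E.
Proof.
move=> b0 mb.
have mEb : measurable_fun setT (fun t => (b t)%:E) by exact/measurable_EFinP.
have b0' t : 0 <= (b t)%:E by rewrite lee_fin.
rewrite !(ms_int _ _ b0' mEb) -ge0_integralD.
- apply: eq_integral => g _; rewrite -ge0_muleDl ?lee_fin// -EFinD.
  by rewrite /wA -mulrDr A_split.
- exact: measurableT.
- by move=> g _; rewrite mule_ge0// lee_fin.
- apply: emeasurable_funM; first exact/measurable_EFinP.
  exact: (measurableT_comp mEb (mqx x)).
- by move=> g _; rewrite mule_ge0// lee_fin.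
- apply: emeasurable_funM; first exact/measurable_EFinP.
  exact: (measurableT_comp mEb (mqx x)).
Qed.

(** The test function is general because the induction absorbs the probability of the last digit
    into it; the bound by 1 survives this and keeps the subtraction finite. *)
Let len_int s x (b : S -> R) : (forall t, (0 <= b t <= 1)%R) ->
  measurable_fun setT b ->
  \int[lam]_g ((w x g)%:E * (len s x (q x g) * b (q x g))%:E) =
  \int[ms s x]_t (b t)%:E.
Proof.
elim: s b => [|d s IH] b b01 mb.
  have b0 t : 0 <= (b t)%:E by rewrite lee_fin; case/andP: (b01 t).
  have mEb : measurable_fun setT (fun t => (b t)%:E) by exact/measurable_EFinP.
  rewrite (ms_int _ _ b0 mEb).
  by apply: eq_integral => g _; rewrite /wA A_nil indicT /= mul1r mulr1.
pose r d t := (if d then p s x t else 1 - p s x t)%R.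
have mr d' : measurable_fun setT (r d').
  rewrite /r; case: d'; first exact: mpx.
  by apply: measurable_funB; [exact: measurable_cst|exact: mpx].
have r01 d' t : (0 <= r d' t <= 1)%R.
  have /andP[? ?] := p01 s x t.
  by rewrite /r; case: d'; apply/andP; split; lra.
have rb01 d' t : (0 <= r d' t * b t <= 1)%R.
  have /andP[? ?] := r01 d' t; have /andP[? ?] := b01 t.
  by apply/andP; split; [exact: mulr_ge0|exact: mulr_ile1].
transitivity (\int[ms s x]_t (r d t * b t)%:E).
  rewrite -(IH _ (rb01 d) (measurable_funM (mr d) mb)).
  by apply: eq_integral => g _; rewrite /= -/(r d _) mulrA.
have rT : \int[ms s x]_t (r true t * b t)%:E = \int[ms (true :: s) x]_t (b t)%:E.
  rewrite -p_int; first exact: eq_integral.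
  - by move=> t; rewrite lee_fin; case/andP: (b01 t).
  - exact/measurable_EFinP.
case: d; first exact: rT.
apply: (integral_complement (p01 s x) (mpx s x) b01 mb (ms_oo s x) _ rT).
by apply: ms_split mb => t; case/andP: (b01 t).
Qed.

Fixpoint random_word (n : nat) (x : X) (t : S) (u : R) : seq bool :=
  if n is n'.+1 then
    let s := random_word n' x t u in
    (lo s x t + len (false :: s) x t <= u)%R :: s
  else [::].

Definition random_digits (x : X) (t : S) (u : R) : cantor_borel :=
  fun n => let s := random_word n x t u in
    (lo s x t + len (false :: s) x t <= u)%R.

Let word_random_digits n x t u : word n (random_digits x t u) = random_word n x t u.
Proof. by elim: n => //= n ->. Qed.

(** The interval of [s] is cut at the right end of its [false] half, and the next digit tells on
    which side of the cut [u] lies. *)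
Let random_wordE s x t u : (0 <= u < 1)%R ->
  cylinder s (random_digits x t u) <-> (lo s x t <= u < lo s x t + len s x t)%R.
Proof.
move=> u01; rewrite /cylinder /= word_random_digits.
elim: s => [|b s IH]; first by rewrite /= add0r u01.
rewrite [random_word _ _ _ _]/=.
have ls := len_split s x t; have lf := len_ge0 (false :: s) x t.
have lt := len_ge0 (true :: s) x t.
have H1 : (random_word (size s) x t u = s /\
    (lo s x t + len (false :: s) x t <= u)%R = b) <->
  (lo (b :: s) x t <= u < lo (b :: s) x t + len (b :: s) x t)%R.
  rewrite IH; case: b; rewrite [lo (_ :: _) _ _]/=
    -?[(len s x t * (1 - p s x t))%R]/(len (false :: s) x t).
    by split => [[/andP[? ?] ?]|/andP[? ?]]; [|split => //]; apply/andP; split; lra.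
  split => [[/andP[? ?] /negbT]|/andP[? ?]].
    by rewrite -ltNge => ?; apply/andP; split; lra.
  by split; [apply/andP; split; lra|apply/negbTE; rewrite -ltNge; lra].
rewrite -H1; split => [[<- E]|[E <-]].
  by rewrite E.
by rewrite E.
Qed.

Let measurable_random_word n s :
  measurable [set z : X * S * R | random_word n z.1.1 z.1.2 z.2 = s].
Proof.
elim: n s => [|n IH] [|b s].
- by rewrite (_ : [set _ | _] = setT)//; apply/seteqP; split.
- by rewrite (_ : [set _ | _] = set0)//; apply/seteqP; split.
- by rewrite (_ : [set _ | _] = set0)//; apply/seteqP; split.
have mlt : measurable [set z : X * S * R |
    (lo s z.1.1 z.1.2 + len (false :: s) z.1.1 z.1.2 <= z.2)%R].
  rewrite -[X in measurable X]setTI; apply: measurable_fun_ler => //.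
  apply: measurable_funD.
    exact: (measurableT_comp (measurable_lo s) measurable_fst).
  exact: (measurableT_comp (measurable_len (false :: s)) measurable_fst).
rewrite (_ : [set _ | _] = [set z | random_word n z.1.1 z.1.2 z.2 = s] `&`
    (if b then [set z : X * S * R |
      (lo s z.1.1 z.1.2 + len (false :: s) z.1.1 z.1.2 <= z.2)%R]
     else ~` [set z : X * S * R |
      (lo s z.1.1 z.1.2 + len (false :: s) z.1.1 z.1.2 <= z.2)%R])).
  by apply: measurableI => //; case: b => //; exact: measurableC.
apply/seteqP; split => [z|z] /=.
  by move=> [<- <-]; split => //; case: ifPn => //= /negP.
by move=> [->]; case: b => /= [->//|/negP/negbTE ->].
Qed.

Let measurable_random_digits :
  measurable_fun setT (fun z : X * S * R => random_digits z.1.1 z.1.2 z.2).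
Proof.
apply: measurable_to_cantor => n.
have := measurable_count_preimage [set s | head false s]
  (measurable_random_word n.+1).
by [].
Qed.

Variable L : {sigma_finite_measure set R -> \bar R}.
(** Uniformity on [0, 1) in the only form used. Since [B] is compared with an interval on [0, 1)
    alone, the case [a = b] forces [L] to vanish elsewhere. *)
Hypothesis LE : forall (B : set R) a b, measurable B ->
  (0 <= a)%R -> (a <= b)%R -> (b <= 1)%R ->
  (forall u, (0 <= u < 1)%R -> B u <-> (a <= u < b)%R) -> L B = (b - a)%:E.

Let measurable_digits_pair x :
  measurable_fun setT (fun z : H * R => random_digits x (q x z.1) z.2).
Proof.
have mg : measurable_fun setT (fun z : H * R => ((x, q x z.1), z.2)).
  apply: measurable_fun_pair; last exact: measurable_snd.
  apply: measurable_fun_pair; first exact: measurable_cst.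
  exact: (measurableT_comp (mqx x) measurable_fst).
exact: (measurableT_comp measurable_random_digits mg).
Qed.

Let measurable_digits_seed x t : measurable_fun setT (random_digits x t).
Proof.
exact: (measurableT_comp measurable_random_digits (measurable_pair1 (x, t))).
Qed.

Let measurable_digits_cylinder s x t :
  measurable [set u | cylinder s (random_digits x t u)].
Proof.
have := measurableT_comp measurable_random_digits (measurable_pair1 (x, t)).
move=> /(_ measurableT _ (measurable_cylinder s)).
by rewrite setTI.
Qed.

Let L_cylinder s x t :
  L [set u | cylinder s (random_digits x t u)] = (len s x t)%:E.
Proof.
have [l0 l1] := lo_len s x t.
rewrite (@LE _ (lo s x t) (lo s x t + len s x t)%R)//.
- by congr (_%:E); ring.
- by rewrite lerDl.
- by move=> u u01; exact: random_wordE.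
Qed.

(** For fixed [B] both sides are finite measures in [D]. On a cylinder the seed contributes the
    length of its interval, and [len_int] identifies the result. *)
Let rectangle x (B : set S) (D : set cantor_borel) :
  measurable B -> measurable D ->
  \int[lam]_g ((w x g * \1_B (q x g))%:E * (\1_D (c g))%:E) =
  \int[lam \x L]_z ((w x z.1 * \1_B (q x z.1))%:E *
    (\1_D (random_digits x (q x z.1) z.2))%:E).
Proof.
move=> mB mD.
pose k1 g : R := (w x g * \1_B (q x g))%R.
have k10 g : (0 <= k1 g)%R by rewrite mulr_ge0.
have mk1 : measurable_fun setT k1.
  by apply: measurable_funM => //; exact: measurable_indic_comp.
pose k2 (z : H * R) : R := k1 z.1.
have k20 z : (0 <= k2 z)%R by exact: k10.
have mk2 : measurable_fun setT k2 by exact: (measurableT_comp mk1 measurable_fst).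
pose N1 := mdensity_pushforward lam k10 mk1 mc.
pose N2 := mdensity_pushforward (lam \x L) k20 mk2 (measurable_digits_pair x).
suff : N1 D = N2 D by [].
apply: (@measure_unique _ R cantor_borel cylinders (fun _ => setT) erefl _ _ _ N1 N2) => //.
- exact: setI_closed_cylinders.
- by move=> _; right; exists [::]; rewrite cylinder_nil.
- by rewrite bigcup_const//; exists 0%N.
- move=> _ [->|[s ->]]; first by rewrite !measure0.
  transitivity (ms s x B).
    rewrite msE; apply: eq_integral => g _; rewrite /k1 /wA -!EFinM; congr (_%:E).
    have -> : (\1_(cylinder s) (c g) = \1_(A s) g :> R)%R by [].
    by rewrite mulrAC.
  transitivity (\int[ms s x]_t (\1_B t)%:E); first by rewrite integral_indic// setIT.
  rewrite -(@len_int s x (\1_B)) => [|t|]; last 2 first.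
  - by rewrite indicE ler0n lern1 leq_b1.
  - exact: measurable_indic.
  rewrite /N2 /= /density_pushforward.
  rewrite (fubini_tonelli1 (fun z => (k2 z)%:E *
    (\1_(cylinder s) (random_digits x (q x z.1) z.2))%:E)); last 2 first.
  - apply: emeasurable_funM; first exact/measurable_EFinP.
    apply: measurable_EFin_indic; first exact: measurable_cylinder.
    exact: measurable_digits_pair.
  - by move=> z; rewrite mule_ge0// lee_fin.
  apply: eq_integral => g _; rewrite /fubini_F /k2 /=.
  rewrite ge0_integralZl//; last 2 first.
  - apply: measurable_EFin_indic; first exact: measurable_cylinder.
    exact: measurable_digits_seed.
  - by rewrite lee_fin.
  have -> : \int[L]_u (\1_(cylinder s) (random_digits x (q x g) u))%:E =
      (len s x (q x g))%:E.
    rewrite -L_cylinder.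
    have := @integral_indic _ _ _ L _ measurableT _
      (measurable_digits_cylinder s x (q x g)).
    by rewrite setIT.
  rewrite /k1 -!EFinM; congr (_%:E).
  by rewrite -mulrA (mulrC (\1_B _)).
- move=> _; apply: le_lt_trans (ms_oo [::] x).
  rewrite msE /= /density_pushforward; apply: ge0_le_integral => //.
  + by move=> g _; rewrite mule_ge0// lee_fin.
  + apply: emeasurable_funM; first exact/measurable_EFinP.
    exact: measurable_EFin_indic.
  + apply: emeasurable_funM; first exact/measurable_EFinP.
    exact: measurable_EFin_indic.
  + move=> g _; rewrite !indicT !mule1 lee_fin /k1 /wA A_nil indicT ler_wpM2l//;
    rewrite ?indicE ?lern1 ?leq_b1//.
Qed.

Let disintegration_digits x (b : S * cantor_borel -> \bar R) :
  (forall z, 0 <= b z) -> measurable_fun setT b ->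
  \int[lam]_g ((w x g)%:E * b (q x g, c g)) =
  \int[lam]_g ((w x g)%:E * \int[L]_u b (q x g, random_digits x (q x g) u)).
Proof.
move=> b0 mb.
have mf1 : measurable_fun setT (fun g => (q x g, c g)).
  exact: measurable_fun_pair.
pose k2 (z : H * R) : R := w x z.1.
have k20 z : (0 <= k2 z)%R by exact: w0.
have mk2 : measurable_fun setT k2 by exact: (measurableT_comp (mwx x) measurable_fst).
have mf2 : measurable_fun setT
    (fun z : H * R => (q x z.1, random_digits x (q x z.1) z.2)).
  apply: measurable_fun_pair => //.
  exact: (measurableT_comp (mqx x) measurable_fst).
pose M1 := mdensity_pushforward lam (w0 x) (mwx x) mf1.
pose M2 := mdensity_pushforward (lam \x L) k20 mk2 mf2.
have -> : \int[lam]_g ((w x g)%:E * b (q x g, c g)) = \int[M1]_z b z.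
  by rewrite integral_density_pushforward.
transitivity (\int[M2]_z b z); last first.
  rewrite integral_density_pushforward//.
  rewrite (fubini_tonelli1 (fun z => (k2 z)%:E *
    b (q x z.1, random_digits x (q x z.1) z.2))); last 2 first.
  - by apply: emeasurable_funM; [exact/measurable_EFinP|exact: (measurableT_comp mb mf2)].
  - by move=> z; rewrite mule_ge0// lee_fin.
  apply: eq_integral => g _; rewrite /fubini_F /k2 /= ge0_integralZl//.
    have mg : measurable_fun setT (fun u => (q x g, random_digits x (q x g) u)).
      by apply: measurable_fun_pair => //; exact: measurable_digits_seed.
    exact: (measurableT_comp mb mg).
  by rewrite lee_fin.
apply: eq_measure_integral => D mD _.
have indX (B : set S) (B' : set cantor_borel) s y :
    (\1_(B `*` B') (s, y) = \1_B s * \1_B' y :> R)%R.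
  rewrite !indicE in_setX /=.
  by case: (_ \in _); case: (_ \in _); rewrite ?mulr0 ?mulr1 ?mul0r.
apply: (@measure_unique _ _ _
  [set B `*` B' | B in @measurable _ S & B' in @measurable _ cantor_borel]
  (fun _ => setT)) => //.
- exact: measurable_prod_measurableType.
- move=> _ _ [X1 mX1 [X2 mX2 <-]] [Y1 mY1 [Y2 mY2 <-]].
  exists (X1 `&` Y1); first exact: measurableI.
  by exists (X2 `&` Y2); [exact: measurableI|rewrite setXI].
- by move=> _; exists setT => //; exists setT => //; rewrite setXTT.
- by rewrite bigcup_const//; exists 0%N.
- move=> _ [B mB [B' mB' <-]].
  transitivity (\int[lam]_g ((w x g * \1_B (q x g))%:E * (\1_B' (c g))%:E)).
    by apply: eq_integral => g _; rewrite indX -!EFinM mulrA.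
  rewrite rectangle//.
  by apply: eq_integral => z _; rewrite indX -!EFinM mulrA.
- move=> _; apply: le_lt_trans (woo x).
  rewrite /= /density_pushforward; under eq_integral do rewrite indicT mule1.
  exact: lexx.
Qed.

Lemma kernel_disintegration : exists Z : X -> S -> R -> H,
  measurable_fun setT (fun z : X * S * R => Z z.1.1 z.1.2 z.2) /\
  forall x (b : S * H -> \bar R), (forall z, 0 <= b z) -> measurable_fun setT b ->
    \int[lam]_g ((w x g)%:E * b (q x g, g)) =
    \int[lam]_g ((w x g)%:E * \int[L]_u b (q x g, Z x (q x g) u)).
Proof.
exists (fun x t u => dc (random_digits x t u)); split.
  exact: (measurableT_comp mdc measurable_random_digits).
move=> x b b0 mb.
rewrite -(@disintegration_digits x (fun z => b (z.1, dc z.2)))//; last first.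
  apply: (measurableT_comp mb); apply: measurable_fun_pair.
    exact: measurable_fst.
  exact: (measurableT_comp mdc measurable_snd).
by apply: eq_integral => g _; rewrite /= cK.
Qed.

End kernel_disintegration.

(** * Averaging over the group *)

Section kernel_construction.
Context dH dS (H : measurableType dH) (S : measurableType dS) (R : realType).
Variables (mul : H -> H -> H) (inv : H -> H) (e : H)
  (lam : {sigma_finite_measure set H -> \bar R}) (act : H -> S -> S)
  (B : nat -> set S) (phi : S -> R)
  (C : nat -> set S) (c : H -> cantor_borel) (dc : cantor_borel -> H)
  (L : {sigma_finite_measure set R -> \bar R}).
Hypotheses (mulA : forall x y z, mul x (mul y z) = mul (mul x y) z)
  (mul1 : forall x, mul e x = x) (mulV : forall x, mul (inv x) x = e)
  (mmul : measurable_fun setT (fun p : H * H => mul p.1 p.2))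
  (minv : measurable_fun setT inv)
  (lamE : forall g A, measurable A -> lam [set mul g h | h in A] = lam A)
  (lamT : lam setT != 0).
Hypotheses (act1 : forall s, act e s = s)
  (actM : forall g h s, act (mul g h) s = act g (act h s))
  (mact : measurable_fun setT (fun p : H * S => act p.1 p.2)).
Hypotheses (mB : forall n, measurable (B n)) (tB : trivIset setT B)
  (BT : \bigcup_n B n = setT)
  (Boo : forall s n, lam [set g | B n (act g s)] < +oo).
Hypotheses (mphi : measurable_fun setT phi) (phiI : injective phi)
  (mC : forall n, measurable (C n))
  (genC : @measurable _ S `<=` <<s range C>>)
  (mc : measurable_fun setT c) (mdc : measurable_fun setT dc)
  (cK : cancel c dc).
Hypothesis (LE : forall (A : set R) a b, measurable A ->
    (0 <= a)%R -> (a <= b)%R -> (b <= 1)%R ->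
    (forall u, (0 <= u < 1)%R -> A u <-> (a <= u < b)%R) -> L A = (b - a)%:E).

Let act_inv g s : act (inv g) (act g s) = s.
Proof. by rewrite -actM mulV act1. Qed.

Let measurable_act d (X : measurableType d) (f : X -> H) (h : X -> S) :
  measurable_fun setT f -> measurable_fun setT h ->
  measurable_fun setT (fun x => act (f x) (h x)).
Proof. by move=> mf mh; exact: (measurableT_comp mact (measurable_fun_pair mf mh)). Qed.

Let measurable_mul d (X : measurableType d) (f h : X -> H) :
  measurable_fun setT f -> measurable_fun setT h ->
  measurable_fun setT (fun x => mul (f x) (h x)).
Proof. exact: measurable_grp_mul. Qed.

Let measurable_inv d (X : measurableType d) (f : X -> H) :
  measurable_fun setT f -> measurable_fun setT (fun x => inv (f x)).
Proof. exact: measurable_grp_inv. Qed.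

Let idx_ex t : {n | B n t}.
Proof.
have Bt : (\bigcup_n B n) t by rewrite BT.
by apply: cid; have [n _ Bn] := Bt; exists n.
Qed.

Let idx t : nat := sval (idx_ex t).

Let idxP t : B (idx t) t. Proof. exact: svalP (idx_ex t). Qed.

Let idxE n : [set t | idx t = n] = B n.
Proof.
apply/seteqP; split => [t /= <-//|t Bt].
by apply: (tB I I); exists t; split.
Qed.

Let measurable_idx n : measurable [set t | idx t = n].
Proof. by rewrite idxE. Qed.

Let mu s n : R := fine (lam [set g | B n (act g s)]).

Let measurable_actB n s : measurable [set g | B n (act g s)].
Proof.
have ms : measurable_fun setT (fun g => act g s) by exact: measurable_act.
by rewrite -[X in measurable X]setTI; exact: ms.
Qed.

Let measurable_mu n : measurable_fun setT (mu ^~ n).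
Proof.
apply: measurableT_comp => //.
rewrite (_ : (fun s => _) = (fun s => \int[lam]_g (\1_(B n) (act g s))%:E)).
  apply: (@measurable_fun_fubini_tonelli_F _ _ _ _ _ lam
    (fun p : S * H => (\1_(B n) (act p.2 p.1))%:E)).
    by apply: measurable_EFin_indic => //; exact: measurable_act.
  by move=> p; rewrite lee_fin.
apply/funext => s.
have := @integral_indic _ _ _ lam _ measurableT _ (measurable_actB n s).
by rewrite setIT.
Qed.

(* The weight of [t] depends on [s] through the masses [mu s n], so that it is
   integrable along the orbit of [s] but positive everywhere. *)
Let omega n s : R := ((2 ^ n.+1)%:R^-1 * (1 + mu s n)^-1)%R.

Let omega_gt0 n s : (0 < omega n s)%R.
Proof.
rewrite mulr_gt0// invr_gt0 ?ltr0n ?expn_gt0//.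
by rewrite ltr_wpDr// fine_ge0.
Qed.

Let weight s t : R := omega (idx t) s.

Let weight_ge0 s t : (0 <= weight s t)%R. Proof. by rewrite ltW// omega_gt0. Qed.

Let measurable_weight d (X : measurableType d) (f h : X -> S) :
  measurable_fun setT f -> measurable_fun setT h ->
  measurable_fun setT (fun x => weight (f x) (h x)).
Proof.
move=> mf mh.
apply: (@measurable_fun_glue _ _ _ _ _ (fun x => idx (h x))
  (fun n x => omega n (f x))) => [n|n].
  by rewrite -[X in measurable X]setTI; exact: mh (measurable_idx n).
apply: measurable_funM => //; apply: measurable_fun_invr_ge0.
  by move=> x; rewrite addr_ge0// fine_ge0.
by apply: measurable_funD => //; exact: (measurableT_comp (measurable_mu n) mf).
Qed.

Let weight_oo s : \int[lam]_g (weight s (act g s))%:E < +oo.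
Proof.
rewrite (@integral_count _ _ _ lam (fun g => idx (act g s))
  (fun n => (omega n s)%:E)); last 2 first.
- move=> n; rewrite -[X in measurable X]/((act ^~ s) @^-1` [set t | idx t = n]).
  by rewrite idxE; exact: measurable_actB.
- by move=> n; rewrite lee_fin ltW.
apply: le_lt_trans (le_trans _ (epsilon_trick0 xpredT (@ler01 R))) (ltry _).
apply: lee_nneseries => [n _ _|n _].
  by rewrite mule_ge0// lee_fin ltW.
rewrite (_ : [set g | idx (act g s) = n] = [set g | B n (act g s)]); last first.
  by rewrite -[LHS]/((act ^~ s) @^-1` [set t | idx t = n]) idxE.
have m0 : (0 <= mu s n)%R by rewrite fine_ge0.
rewrite [X in _ * X](_ : _ = (mu s n)%:E); last first.
  by rewrite /mu fineK// ge0_fin_numE//; exact: Boo.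
(* The factor [mu s n / (1 + mu s n)] is at most 1, which leaves the summable [2^-(n+1)]. *)
rewrite -EFinM lee_fin /omega mul1r -mulrA.
rewrite -[leRHS]mulr1 ler_wpM2l// mulrC ler_pdivrMr ?mul1r ?lerDr//.
by rewrite ltr_wpDr.
Qed.

Let pos_index s : exists n, lam [set g | B n (act g s)] != 0.
Proof.
apply: contrapT => h; move/eqP: lamT; apply.
rewrite -[RHS](@integral0 _ _ _ lam setT) -[LHS]mul1e -(integral_cst _ measurableT).
rewrite (@integral_count _ _ _ lam (fun g => idx (act g s)) (fun=> 1)); last 2 first.
- move=> n; rewrite -[X in measurable X]/((act ^~ s) @^-1` [set t | idx t = n]).
  by rewrite idxE; exact: measurable_actB.
- by [].
rewrite integral0; apply: eseries0 => n _ _.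
rewrite (_ : [set g | idx (act g s) = n] = [set g | B n (act g s)]); last first.
  by rewrite -[LHS]/((act ^~ s) @^-1` [set t | idx t = n]) idxE.
rewrite mul1e; apply/eqP; apply: contrapT => ne; apply: h; exists n.
exact/negP.
Qed.

(** The yardstick is the set of group elements taking [point] into some [B n]. Its right translates
    are the visits of other points of that orbit to [B n], so properness makes all of them
    finite. *)
Let modular k : exists2 r : R, (0 < r)%R & forall F : H -> \bar R,
  (forall x, 0 <= F x) -> measurable_fun setT F ->
  \int[lam]_x F (mul x k) = r%:E * \int[lam]_x F x.
Proof.
have [n n0] := pos_index point.
apply: (haar_mulr mulA mul1 mulV mmul minv lamE lamT k
  (measurable_actB n point) n0) => x.
have -> : \int[lam]_y (\1_[set g | B n (act g point)] (mul y x))%:E =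
    \int[lam]_y (\1_[set g | B n (act g (act x point))] y)%:E.
  apply: eq_integral => y _; rewrite !indicE.
  by congr ((_ : bool)%:R%:E); apply/idP/idP; rewrite !inE /= actM.
by rewrite integral_indic// setIT; exact: Boo.
Qed.

Let N s t : \bar R := \int[lam]_g (weight s (act g t))%:E.

Let N_ge0 s t : 0 <= N s t.
Proof. by apply: integral_ge0 => g _; rewrite lee_fin. Qed.

Let measurable_N : measurable_fun setT (fun p : S * S => N p.1 p.2).
Proof.
apply: (@measurable_fun_fubini_tonelli_F _ _ _ _ _ lam
  (fun p : (S * S) * H => (weight p.1.1 (act p.2 p.1.2))%:E)).
  apply/measurable_EFinP; apply: measurable_weight.
    exact: (measurableT_comp measurable_fst measurable_fst).
  apply: measurable_act; first exact: measurable_snd.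
  exact: (measurableT_comp measurable_snd measurable_fst).
by move=> p; rewrite lee_fin.
Qed.

Let measurable_weight_act s t : measurable_fun setT (fun g => weight s (act g t)).
Proof. by apply: measurable_weight => //; exact: measurable_act. Qed.

Let N_act k r s t : (forall F : H -> \bar R,
    (forall x, 0 <= F x) -> measurable_fun setT F ->
    \int[lam]_x F (mul x k) = r%:E * \int[lam]_x F x) ->
  N s (act k t) = r%:E * N s t.
Proof.
move=> kr; rewrite /N -kr//.
- by apply: eq_integral => g _; rewrite actM.
- by move=> g; rewrite lee_fin.
- exact/measurable_EFinP.
Qed.

(** At [t = s] finiteness is [weight_oo], and positivity comes from a set [B n] visited with
    positive measure. The modular factor carries both along the orbit. *)
Let N_orbit s x : (0 < fine (N s (act x s)))%R /\ N s (act x s) \is a fin_num.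
Proof.
have Nss : 0 < N s s < +oo.
  rewrite weight_oo andbT lt_neqAle N_ge0 andbT eq_sym; apply/eqP => N0.
  have [n /eqP n0] := pos_index s; apply: n0.
  have mle : (omega n s)%:E * lam [set g | B n (act g s)] <= N s s.
    have <- : \int[lam]_g ((omega n s)%:E * (\1_[set g | B n (act g s)] g)%:E) =
        (omega n s)%:E * lam [set g | B n (act g s)].
      rewrite ge0_integralZl//.
      - by rewrite integral_indic// setIT.
      - apply/measurable_EFinP; exact: measurable_indic.
      - by rewrite lee_fin ltW.
    apply: ge0_le_integral => //.
    - by move=> g _; rewrite mule_ge0// lee_fin// ltW.
    - apply: emeasurable_funM => //; apply/measurable_EFinP; exact: measurable_indic.
    - exact/measurable_EFinP.
    - move=> g _; rewrite indicE; case: (boolP (g \in _)) => [|_].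
        rewrite inE /= => Bg; rewrite mule1 lee_fin /weight.
        suff -> : idx (act g s) = n by [].
        by have : [set t | idx t = n] (act g s) by rewrite idxE.
      by rewrite mule0 lee_fin.
  have : (omega n s)%:E * lam [set g | B n (act g s)] == 0.
    by rewrite eq_le mule_ge0 ?lee_fin ?(ltW (omega_gt0 _ _))// andbT -N0.
  rewrite mule_eq0 => /orP[|/eqP//].
  by rewrite eqe gt_eqF.
have [r r0 kr] := modular x.
rewrite (N_act _ _ kr); have /andP[N0 Noo] := Nss.
have Nfin : N s s \is a fin_num by rewrite ge0_fin_numE// ltW.
split; last by rewrite fin_numM.
by rewrite fineM// mulr_gt0// fine_gt0// N0.
Qed.

Let Z_ex : {Z : S -> S -> R -> H |
  measurable_fun setT (fun z : S * S * R => Z z.1.1 z.1.2 z.2) /\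
  forall s (b : S * H -> \bar R), (forall z, 0 <= b z) -> measurable_fun setT b ->
    \int[lam]_g ((weight s (act g s))%:E * b (act g s, g)) =
    \int[lam]_g ((weight s (act g s))%:E *
      \int[L]_u b (act g s, Z s (act g s) u))}.
Proof.
apply: cid; apply: (@kernel_disintegration _ _ _ S S H R lam
  (fun s g => weight s (act g s)) (fun s g => act g s) C c dc) => //.
- by apply: measurable_weight => //; exact: measurable_act.
- exact: measurable_act.
Qed.

Let Z : S -> S -> R -> H := sval Z_ex.

Let measurable_Z d (X : measurableType d) (f h : X -> S) (k : X -> R) :
  measurable_fun setT f -> measurable_fun setT h -> measurable_fun setT k ->
  measurable_fun setT (fun x => Z (f x) (h x) (k x)).
Proof.
move=> mf mh mk; have [mZ _] := svalP Z_ex.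
exact: (measurableT_comp mZ (measurable_fun_pair (measurable_fun_pair mf mh) mk)).
Qed.

Let Z_int s (b : S * H -> \bar R) :
  (forall z, 0 <= b z) -> measurable_fun setT b ->
  \int[lam]_g ((weight s (act g s))%:E * b (act g s, g)) =
  \int[lam]_g ((weight s (act g s))%:E *
    \int[L]_u b (act g s, Z s (act g s) u)).
Proof. by have [_ h] := svalP Z_ex; exact: h. Qed.

(** * The averaged kernel *)

Let diag : set (S * S) := [set p | p.1 = p.2].

Let measurable_diag d (X : measurableType d) (f h : X -> S) :
  measurable_fun setT f -> measurable_fun setT h ->
  measurable_fun setT (fun x => \1_diag (f x, h x) : R).
Proof.
move=> mf mh; apply: (@measurable_indic_comp _ _ _ _ _ (fun x => (f x, h x))).
  have E : diag = [set p | (phi p.1 <= phi p.2)%R] `&` [set p | (phi p.2 <= phi p.1)%R].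
    apply/seteqP; split => [p /= ->//|p /= [h1 h2]].
    by apply: phiI; apply/eqP; rewrite eq_le h1 h2.
  rewrite E; apply: measurableI; rewrite -[X in measurable X]setTI;
    apply: measurable_fun_ler => //;
    by [exact: (measurableT_comp mphi measurable_fst)|
        exact: (measurableT_comp mphi measurable_snd)].
exact: measurable_fun_pair.
Qed.

(** Where [N s t] is infinite, [fine] and the inverse both default to 0, so the kernel vanishes
    there and invariance is not disturbed. *)
Let cN s t : R := (fine (N s t))^-1%R.

Let cN_ge0 s t : (0 <= cN s t)%R. Proof. by rewrite invr_ge0 fine_ge0. Qed.

Let measurable_cN d (X : measurableType d) (f h : X -> S) :
  measurable_fun setT f -> measurable_fun setT h ->
  measurable_fun setT (fun x => cN (f x) (h x)).
Proof.
move=> mf mh; apply: measurable_fun_invr_ge0; first by move=> x; exact: fine_ge0.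
apply: measurableT_comp => //.
exact: (measurableT_comp measurable_N (measurable_fun_pair mf mh)).
Qed.

(** The disintegration places [Z] in [G_{s,gt}] only almost surely; this factor imposes it
    pointwise, so that concentration holds for every [t]. *)
Let hit s t g u : R := \1_diag (act (Z s (act g t) u) s, act g t).

Let measurable_hit d (X : measurableType d) (f h : X -> S) (k : X -> H) (l : X -> R) :
  measurable_fun setT f -> measurable_fun setT h ->
  measurable_fun setT k -> measurable_fun setT l ->
  measurable_fun setT (fun x => hit (f x) (h x) (k x) (l x)).
Proof.
move=> mf mh mk ml; apply: measurable_diag; last exact: measurable_act.
apply: measurable_act => //; apply: measurable_Z => //; exact: measurable_act.
Qed.

Let density s t (z : H * R) : R := (cN s t * (weight s (act z.1 t) * hit s t z.1 z.2))%R.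

(** On a hit [Z] moves [s] to [g t], so [g^-1 Z] moves [s] to [t]. *)
Let target s t (z : H * R) : H := mul (inv z.1) (Z s (act z.1 t) z.2).

Let density_ge0 s t z : (0 <= density s t z)%R.
Proof. by rewrite mulr_ge0// mulr_ge0. Qed.

Let measurable_density d (X : measurableType d) (f h : X -> S) (k : X -> H * R) :
  measurable_fun setT f -> measurable_fun setT h -> measurable_fun setT k ->
  measurable_fun setT (fun x => density (f x) (h x) (k x)).
Proof.
move=> mf mh mk.
have mk1 : measurable_fun setT (fun x => (k x).1).
  exact: (measurableT_comp measurable_fst mk).
have mk2 : measurable_fun setT (fun x => (k x).2).
  exact: (measurableT_comp measurable_snd mk).
apply: measurable_funM; first exact: measurable_cN.
apply: measurable_funM; last exact: measurable_hit.
by apply: measurable_weight => //; exact: measurable_act.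
Qed.

Let measurable_target d (X : measurableType d) (f h : X -> S) (k : X -> H * R) :
  measurable_fun setT f -> measurable_fun setT h -> measurable_fun setT k ->
  measurable_fun setT (fun x => target (f x) (h x) (k x)).
Proof.
move=> mf mh mk.
have mk1 : measurable_fun setT (fun x => (k x).1).
  exact: (measurableT_comp measurable_fst mk).
have mk2 : measurable_fun setT (fun x => (k x).2).
  exact: (measurableT_comp measurable_snd mk).
apply: measurable_mul; first exact: measurable_inv.
by apply: measurable_Z => //; exact: measurable_act.
Qed.

Let kappa_ex st : {m : {measure set H -> \bar R} |
  (forall A, m A = \int[lam \x L]_z
    ((density st.1 st.2 z)%:E * (\1_A (target st.1 st.2 z))%:E)) /\
  (forall f, (forall h, 0 <= f h) -> measurable_fun setT f ->
    \int[m]_h f h = \int[lam \x L]_z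
      ((density st.1 st.2 z)%:E * f (target st.1 st.2 z)))}.
Proof.
have md : measurable_fun setT (density st.1 st.2) by exact: measurable_density.
have mt : measurable_fun setT (target st.1 st.2) by exact: measurable_target.
exists (mdensity_pushforward (lam \x L) (density_ge0 st.1 st.2) md mt); split => //.
by move=> f f0 mf; exact: integral_density_pushforward.
Qed.

Let kappa st : {measure set H -> \bar R} := sval (kappa_ex st).

Let kappaE st A : kappa st A = \int[lam \x L]_z
  ((density st.1 st.2 z)%:E * (\1_A (target st.1 st.2 z))%:E).
Proof. by have [h _] := svalP (kappa_ex st); exact: h. Qed.

Let inner s t (f : H -> \bar R) g : \bar R :=
  (weight s (act g t))%:E *
  \int[L]_u ((hit s t g u)%:E * f (target s t (g, u))).

Let inner_ge0 s t f g : (forall h, 0 <= f h) -> 0 <= inner s t f g.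
Proof.
move=> f0; rewrite mule_ge0 ?lee_fin//; apply: integral_ge0 => u _.
by rewrite mule_ge0// lee_fin.
Qed.

Let measurable_inner2 d (X : measurableType d) (s : X -> S) (t : X -> S)
    (f : X -> H -> \bar R) (k : X -> H) :
  measurable_fun setT s -> measurable_fun setT t ->
  (forall x h, 0 <= f x h) -> measurable_fun setT (fun p : X * H => f p.1 p.2) ->
  measurable_fun setT k ->
  measurable_fun setT (fun x => inner (s x) (t x) (f x) (k x)).
Proof.
move=> ms mt f0 mf mk; apply: emeasurable_funM.
  by apply/measurable_EFinP; apply: measurable_weight => //; exact: measurable_act.
apply: (@measurable_fun_fubini_tonelli_F _ _ _ _ _ L (fun p : X * R =>
  (hit (s p.1) (t p.1) (k p.1) p.2)%:E * f p.1 (target (s p.1) (t p.1) (k p.1, p.2)))).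
  have ms1 : measurable_fun setT (fun p : X * R => s p.1).
    exact: (measurableT_comp ms measurable_fst).
  have mt1 : measurable_fun setT (fun p : X * R => t p.1).
    exact: (measurableT_comp mt measurable_fst).
  have mk1 : measurable_fun setT (fun p : X * R => k p.1).
    exact: (measurableT_comp mk measurable_fst).
  apply: emeasurable_funM.
    by apply/measurable_EFinP; apply: measurable_hit => //; exact: measurable_snd.
  have mtg : measurable_fun setT
      (fun p : X * R => (p.1, target (s p.1) (t p.1) (k p.1, p.2))).
    apply: measurable_fun_pair; first exact: measurable_fst.
    apply: measurable_target; [exact: ms1|exact: mt1|].
    by apply: measurable_fun_pair; [exact: mk1|exact: measurable_snd].
  have mftg := measurableT_comp mf mtg.
  exact: mftg.
by move=> p; rewrite mule_ge0// lee_fin.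
Qed.

Let measurable_inner s t f : (forall h, 0 <= f h) -> measurable_fun setT f ->
  measurable_fun setT (inner s t f).
Proof.
move=> f0 mf.
apply: (@measurable_inner2 _ H (fun=> s) (fun=> t) (fun=> f) id) => //.
exact: (measurableT_comp mf measurable_snd).
Qed.

Let kappa_int s t f : (forall h, 0 <= f h) -> measurable_fun setT f ->
  \int[kappa (s, t)]_h f h = (cN s t)%:E * \int[lam]_g inner s t f g.
Proof.
move=> f0 mf; have [_ h] := svalP (kappa_ex (s, t)); rewrite {}[LHS]h//=.
have mhf : measurable_fun setT (fun z : H * R =>
    (weight s (act z.1 t))%:E * ((hit s t z.1 z.2)%:E * f (target s t z))).
  apply: emeasurable_funM.
    apply/measurable_EFinP; apply: measurable_weight => //.
    by apply: measurable_act => //; exact: measurable_fst.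
  apply: emeasurable_funM.
    by apply/measurable_EFinP; apply: measurable_hit.
  by apply: (measurableT_comp mf); exact: measurable_target.
have hf0 z : 0 <= (weight s (act z.1 t))%:E * ((hit s t z.1 z.2)%:E * f (target s t z)).
  by rewrite !mule_ge0// lee_fin.
transitivity ((cN s t)%:E * \int[lam \x L]_z
    ((weight s (act z.1 t))%:E * ((hit s t z.1 z.2)%:E * f (target s t z)))).
  rewrite -ge0_integralZl//; last by rewrite lee_fin.
  by apply: eq_integral => z _; rewrite /density !EFinM !muleA.
congr (_ * _).
rewrite (fubini_tonelli1 (fun z => (weight s (act z.1 t))%:E *
  ((hit s t z.1 z.2)%:E * f (target s t z))))//.
apply: eq_integral => g _; rewrite /fubini_F /inner /= ge0_integralZl//.
- apply: emeasurable_funM.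
    by apply/measurable_EFinP; apply: measurable_hit.
  by apply: (measurableT_comp mf); apply: measurable_target => //;
    exact: measurable_fun_pair.
- by move=> u _; rewrite mule_ge0// lee_fin.
- by rewrite lee_fin.
Qed.

(** As [k (g k)^-1 = g^-1], replacing [t] by [k t] is a right translation in [g] together with a
    left translation of the argument of [f]. *)
Let inner_shift s t k f g :
  inner s (act k t) f g = inner s t (fun h => f (mul k h)) (mul g k).
Proof.
rewrite /inner /hit /target /= actM; congr (_ * _).
apply: eq_integral => u _; congr (_ * f _).
by rewrite (grp_invM mulA mul1 mulV) -mulA (grp_mulVK mulA mul1 mulV).
Qed.

Let kappa_shift s t k f : (forall h, 0 <= f h) -> measurable_fun setT f ->
  \int[kappa (s, act k t)]_h f h = \int[kappa (s, t)]_h f (mul k h).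
Proof.
move=> f0 mf.
have mfk : measurable_fun setT (fun h => f (mul k h)).
  by apply: (measurableT_comp mf); exact: measurable_mul.
have [r r0 kr] := modular k.
have fk0 h : 0 <= f (mul k h) by exact: f0.
rewrite (kappa_int _ _ f0 mf) (kappa_int _ _ fk0 mfk).
rewrite (eq_integral _ _ (fun g _ => inner_shift s t k f g)).
rewrite (kr _ (fun g => inner_ge0 s t g fk0) (measurable_inner s t fk0 mfk)).
rewrite muleA -EFinM; congr (_%:E * _); rewrite /cN (N_act _ _ kr).
(* The identity must also hold for infinite [N s t], where both sides are 0; this gives invariance
   off the orbit of [s]. *)
have -> : (fine (r%:E * N s t) = r * fine (N s t))%R.
  case: (N s t) => [x //| |] /=.
    by rewrite gt0_muley ?lte_fin//= mulr0.
  by rewrite gt0_muleNy ?lte_fin//= mulr0.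
by rewrite invfM mulrAC mulVf ?mul1r// gt_eqF.
Qed.

(** Exact invariance reduces to [t = s]. There [Z_int], applied to the event that the second
    coordinate moves [s] to the first, shows that [hit] costs no mass, so the numerator is
    [N s s]. *)
Let kappa_mass s x : kappa (s, act x s) setT = 1.
Proof.
pose f (h : H) : \bar R := 1.
have f0 h : 0 <= f h by exact: lee01.
have mf : measurable_fun setT f by exact: measurable_cst.
have -> : kappa (s, act x s) setT = \int[kappa (s, act x s)]_h f h.
  by rewrite /f integral_cst// mul1e.
rewrite (kappa_shift _ _ _ f0 mf) (kappa_int _ _ f0 mf).
have E : \int[lam]_g inner s s f g = N s s.
  pose b (z : S * H) : \bar R := (\1_diag (act z.2 s, z.1))%:E.
  have := @Z_int s b.
  rewrite /inner => h; transitivity (\int[lam]_g ((weight s (act g s))%:E *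
    \int[L]_u b (act g s, Z s (act g s) u))).
    apply: eq_integral => g _; congr (_ * _); apply: eq_integral => u _.
    by rewrite mule1.
  rewrite -h; last 2 first.
  - by move=> z; rewrite lee_fin.
  - apply/measurable_EFinP; apply: measurable_diag; last exact: measurable_fst.
    by apply: measurable_act => //; exact: measurable_snd.
  apply: eq_integral => g _; rewrite /b indicE mem_set ?mule1//.
rewrite E; have [N0 Nfin] := N_orbit s e; rewrite act1 in N0 Nfin.
by rewrite -(fineK Nfin) -EFinM mulVf// gt_eqF.
Qed.

Let kappa_concentrated s t :
  kappa (s, t) (~` [set g | act g s = t]) = 0.
Proof.
rewrite kappaE; apply: integral0_eq => z _ /=.
rewrite /density /hit !indicE.
case: (boolP ((_, _) \in diag)) => [|_]; last by rewrite !mulr0 mul0e.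
rewrite inE /diag /= => hz; rewrite memNset ?mule0//=; apply.
by rewrite /target actM hz act_inv.
Qed.

(** Insert [1 = cN * N] on the left and expand the kernel on the right. After exchanging integrals
    it suffices to compare for each fixed averaging variable [g], where a left translation reduces
    the claim to [Z_int]. *)
Let kappa_formula s (f : S * H -> \bar R) :
  measurable_fun setT f -> (forall x, 0 <= f x) ->
  \int[lam]_g f (act g s, g) =
  \int[lam]_x \int[kappa (s, act x s)]_g f (act x s, g).
Proof.
move=> mf f0.
have mft t : measurable_fun setT (fun g => f (t, g)).
  exact: (measurableT_comp mf (measurable_pair1 t)).
have mas : measurable_fun setT (fun x => act x s) by exact: measurable_act.
have mas1 : measurable_fun setT (fun p : H * H => act p.1 s).
  exact: (measurableT_comp mas measurable_fst).
pose Psi (p : H * H) := (cN s (act p.1 s))%:E *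
  inner s (act p.1 s) (fun h => f (act p.1 s, h)) p.2.
have Psi0 p : 0 <= Psi p.
  by rewrite mule_ge0 ?lee_fin//; exact: inner_ge0.
have mPsi : measurable_fun setT Psi.
  apply: emeasurable_funM.
    by apply/measurable_EFinP; exact: measurable_cN.
  apply: (@measurable_inner2 _ _ (fun=> s) (fun p : H * H => act p.1 s)
    (fun p h => f (act p.1 s, h)) snd).
  - exact: measurable_cst.
  - exact: mas1.
  - by move=> p h; exact: f0.
  - have mg : measurable_fun setT (fun p : H * H * H => (act p.1.1 s, p.2)).
      apply: measurable_fun_pair; last exact: measurable_snd.
      exact: (measurableT_comp mas1 measurable_fst).
    exact: (measurableT_comp mf mg).
  - exact: measurable_snd.
pose Xi (p : H * H) := (weight s (act (mul p.2 p.1) s))%:E *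
  ((cN s (act p.1 s))%:E * f (act p.1 s, p.1)).
have Xi0 p : 0 <= Xi p by rewrite !mule_ge0// lee_fin.
have mXi : measurable_fun setT Xi.
  apply: emeasurable_funM.
    apply/measurable_EFinP; apply: measurable_weight => //.
    apply: measurable_act => //; apply: measurable_mul.
      exact: measurable_snd.
    exact: measurable_fst.
  apply: emeasurable_funM; first by apply/measurable_EFinP; exact: measurable_cN.
  have mg : measurable_fun setT (fun p : H * H => (act p.1 s, p.1)).
    by apply: measurable_fun_pair => //; exact: measurable_fst.
  exact: (measurableT_comp mf mg).
transitivity (\int[lam]_x \int[lam]_g Xi (x, g)).
  apply: eq_integral => x _; rewrite /Xi /=.
  under eq_integral do rewrite actM.
  rewrite ge0_integralZr//; last 3 first.
  - exact/measurable_EFinP.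
  - by move=> g _; rewrite lee_fin.
  - by rewrite mule_ge0// lee_fin.
  have [N0 Nfin] := N_orbit s x.
  rewrite -/(N s (act x s)) muleA -(fineK Nfin) -EFinM mulfV ?mul1e//.
  by rewrite gt_eqF.
transitivity (\int[lam]_x \int[lam]_g Psi (x, g)); last first.
  apply: eq_integral => x _.
  have fx0 h : 0 <= f (act x s, h) by exact: f0.
  rewrite (kappa_int _ _ fx0 (mft (act x s))) /Psi /= ge0_integralZl.
  - by [].
  - exact: measurableT.
  - exact: (measurable_inner s (act x s) fx0 (mft (act x s))).
  - by move=> g _; exact: inner_ge0.
  - by rewrite lee_fin.
rewrite (fubini_tonelli Xi mXi Xi0) (fubini_tonelli Psi mPsi Psi0).
apply: eq_integral => g _.
have mPsig : measurable_fun setT (fun x => Psi (x, g)).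
  exact: (measurableT_comp mPsi (measurable_pair2 g)).
(* Replacing [x] by [g^-1 x] turns the conditioning point [g x s] into [x s], the form that [Z_int]
   expects. *)
rewrite -(@integral_mull _ _ _ _ _ _ _ mulA mul1 mulV mmul lamE (inv g)
  (fun x => Psi (x, g)) (fun x => Psi0 (x, g)) mPsig).
(* Undoes the translation inside the test function. Its diagonal factor is 1 at [(x s, x)] and
   becomes [hit] once [x] is replaced by [Z]. *)
pose b (z : S * H) : \bar R := (cN s (act (inv g) z.1))%:E *
  ((\1_diag (act z.2 s, z.1))%:E * f (act (inv g) z.1, mul (inv g) z.2)).
have b0 z : 0 <= b z by rewrite !mule_ge0// lee_fin.
have mb : measurable_fun setT b.
  have m1 : measurable_fun setT (fun z : S * H => act (inv g) z.1).
    by apply: measurable_act => //; exact: measurable_fst.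
  have m2 : measurable_fun setT (fun z : S * H => act z.2 s).
    by apply: measurable_act => //; exact: measurable_snd.
  apply: emeasurable_funM; first by apply/measurable_EFinP; exact: measurable_cN.
  apply: emeasurable_funM.
    by apply/measurable_EFinP; apply: measurable_diag => //; exact: measurable_fst.
  have mg : measurable_fun setT
      (fun z : S * H => (act (inv g) z.1, mul (inv g) z.2)).
    apply: measurable_fun_pair; first exact: m1.
    by apply: measurable_mul; [exact: measurable_cst|exact: measurable_snd].
  exact: (measurableT_comp mf mg).
transitivity (\int[lam]_x ((weight s (act x s))%:E * b (act x s, x))).
  rewrite -[RHS](@integral_mull _ _ _ _ _ _ _ mulA mul1 mulV mmul lamE g
    (fun x => (weight s (act x s))%:E * b (act x s, x))); last 2 first.
  - by move=> x; rewrite mule_ge0// lee_fin.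
  - apply: emeasurable_funM; first exact/measurable_EFinP.
    exact: (measurableT_comp mb (measurable_fun_pair mas (@measurable_id _ _ _))).
  apply: eq_integral => x _; rewrite /Xi /b /=; congr (_ * _).
  rewrite indicE mem_set// mul1e (grp_mulK mulA mul1 mulV) actM act_inv.
  by [].
rewrite (Z_int s b0 mb); apply: eq_integral => x _; rewrite /Psi /inner /hit /target /=.
have E : act g (act (mul (inv g) x) s) = act x s.
  by rewrite -actM (grp_mulVK mulA mul1 mulV).
rewrite E muleCA; congr (_ * _).
rewrite -ge0_integralZl.
- by apply: eq_integral => u _; rewrite /b /= actM.
- exact: measurableT.
- have mZ : measurable_fun setT (fun u => Z s (act x s) u) by exact: measurable_Z.
  apply: emeasurable_funM.
    apply/measurable_EFinP; apply: measurable_diag => //.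
    exact: measurable_act.
  by apply: (measurableT_comp (mft _)); exact: measurable_mul.
- by move=> u _; rewrite mule_ge0// lee_fin.
- by rewrite lee_fin.
Qed.

Let measurable_kappa_int d (X : measurableType d) (s t : X -> S)
    (f : X * H -> \bar R) : measurable_fun setT s -> measurable_fun setT t ->
  measurable_fun setT f -> (forall x, 0 <= f x) ->
  measurable_fun setT (fun x => \int[kappa (s x, t x)]_g f (x, g)).
Proof.
move=> ms mt mf f0.
rewrite (_ : (fun x => _) = (fun x => (cN (s x) (t x))%:E *
    \int[lam]_g inner (s x) (t x) (fun h => f (x, h)) g)); last first.
  apply/funext => x; apply: kappa_int => //.
  exact: (measurableT_comp mf (measurable_pair1 x)).
apply: emeasurable_funM; first by apply/measurable_EFinP; exact: measurable_cN.
apply: (@measurable_fun_fubini_tonelli_F _ _ _ _ _ lam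
  (fun p : X * H => inner (s p.1) (t p.1) (fun h => f (p.1, h)) p.2)).
  apply: (@measurable_inner2 _ _ (fun p : X * H => s p.1) (fun p => t p.1)
    (fun (p : X * H) h => f (p.1, h)) snd).
  - exact: (measurableT_comp ms measurable_fst).
  - exact: (measurableT_comp mt measurable_fst).
  - by move=> p h; exact: f0.
  - have mg : measurable_fun setT (fun p : X * H * H => (p.1.1, p.2)).
      apply: measurable_fun_pair; last exact: measurable_snd.
      exact: (measurableT_comp measurable_fst measurable_fst).
    exact: (measurableT_comp mf mg).
  - exact: measurable_snd.
by move=> p; exact: inner_ge0.
Qed.

Let kappa_indic st A : measurable A -> kappa st A = \int[kappa st]_h (\1_A h)%:E.
Proof. by move=> mA; rewrite integral_indic// setIT. Qed.

Let measurable_kappa A : measurable A -> measurable_fun setT (kappa ^~ A).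
Proof.
move=> mA.
rewrite (_ : kappa ^~ A = (fun st => \int[kappa (st.1, st.2)]_h (\1_A h)%:E)).
  apply: (@measurable_kappa_int _ _ fst snd (fun p : (S * S) * H => (\1_A p.2)%:E)).
  - exact: measurable_fst.
  - exact: measurable_snd.
  - by apply: measurable_EFin_indic => //; exact: measurable_snd.
  - by move=> p; rewrite lee_fin.
by apply/funext => -[s t]; exact: kappa_indic.
Qed.

HB.instance Definition _ := isKernel.Build _ _ _ _ R kappa measurable_kappa.

Lemma invariant_disintegration : exists kap : R.-ker (S * S)%type ~> H,
  [/\ (forall (s : S) (f : S * H -> \bar R),
         measurable_fun setT f -> (forall x, 0 <= f x) ->
         \int[lam]_g f (act g s, g) =
         \int[pushforward lam (fun g => act g s)]_t \int[kap (s, t)]_g f (t, g)),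
      (forall g s t A, measurable A ->
         kap (s, act g t) A = kap (s, t) [set h | A (mul g h)]),
      (forall s t, kap (s, t) (~` [set g | act g s = t]) = 0) &
      (forall s g, kap (s, act g s) setT = 1)].
Proof.
exists (kappa : R.-ker _ ~> _); split.
- move=> s f mf f0; rewrite kappa_formula//.
  have mas : measurable_fun setT (fun x => act x s) by exact: measurable_act.
  rewrite (@ge0_integral_pushforward _ _ _ _ _ _ mas lam setT
    (fun t => \int[kappa (s, t)]_g f (t, g)))//.
    exact: (@measurable_kappa_int _ S (fun=> s) id f).
  by move=> t _; exact: integral_ge0.
- move=> g s t A mA.
  have mAg : measurable [set h | A (mul g h)].
    have mg : measurable_fun setT (fun h => mul g h) by exact: measurable_mul.
    by rewrite -[X in measurable X]setTI; exact: mg.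
  transitivity (\int[kappa (s, act g t)]_h (\1_A h)%:E); first exact: kappa_indic.
  rewrite kappa_shift//; last exact: measurable_EFin_indic.
  exact/esym/kappa_indic.
- exact: kappa_concentrated.
- exact: kappa_mass.
Qed.

End kernel_construction.

(** * The topological setting *)

(** An alias indexed by the proof, so that a measure shown sigma-finite inside a proof can carry the
    canonical structure. *)
Definition sigma_finite_wrap d (T : measurableType d) (R : realType)
    (m : {measure set T -> \bar R}) of sigma_finite setT m : set T -> \bar R := m.

HB.instance Definition _ d (T : measurableType d) (R : realType)
    (m : {measure set T -> \bar R}) (sf : sigma_finite setT m) :=
  Measure.copy (sigma_finite_wrap sf) m.

HB.instance Definition _ d (T : measurableType d) (R : realType)
    (m : {measure set T -> \bar R}) (sf : sigma_finite setT m) :=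
  @Measure_isSigmaFinite.Build _ _ _ (sigma_finite_wrap sf) sf.

(* The density moves Lebesgue measure from [measurableTypeR R] to [R], whose
   canonical measurable structure has another display. *)
Lemma uniform_measure (R : realType) : exists L : {sigma_finite_measure set R -> \bar R},
  forall (A : set R) a b, measurable A ->
    (0 <= a)%R -> (a <= b)%R -> (b <= 1)%R ->
    (forall u, (0 <= u < 1)%R -> A u <-> (a <= u < b)%R) -> L A = (b - a)%:E.
Proof.
pose I01 : set (measurableTypeR R) := `[0%R, 1%R[%classic.
have mI : measurable I01 by exact: measurable_itv.
have mid : measurable_fun setT (fun x : measurableTypeR R => x : R).
  by move=> _ A mA; rewrite setTI.
have I0 x : (0 <= \1_I01 x :> R)%R by [].
have mi : measurable_fun setT (\1_I01 : measurableTypeR R -> R).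
  exact: measurable_indic.
pose m := mdensity_pushforward lebesgue_measure I0 mi mid.
have mE (A : set R) a b : measurable A ->
    (0 <= a)%R -> (a <= b)%R -> (b <= 1)%R ->
    (forall u, (0 <= u < 1)%R -> A u <-> (a <= u < b)%R) -> m A = (b - a)%:E.
  move=> mA a0 ab b1 H.
  have -> : (b - a)%:E = lebesgue_measure (`[a, b[%classic : set R).
    rewrite lebesgue_measure_itv /= lte_fin.
    by move: ab; rewrite le_eqVlt => /predU1P[->|->]; rewrite ?ltxx ?subrr.
  rewrite -[X in lebesgue_measure X]setIT -integral_indic//.
  apply: eq_integral => u _; rewrite -EFinM !indicE; congr (_%:E).
  have [u01|u01] := boolP (0 <= u < 1)%R.
    rewrite (@mem_set _ I01); last by rewrite /I01 /= in_itv.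
    rewrite mul1r; congr ((_ : bool)%:R)%R; apply/idP/idP; rewrite !inE /= in_itv /=;
      by move/H; exact.
  rewrite (@memNset _ I01); last by rewrite /I01 /= in_itv; exact/negP.
  have nu : ~ (`[a, b[%classic : set R) u.
    rewrite /= in_itv /= => /andP[au ub].
    by move/negP: u01; apply; apply/andP; split; lra.
  by rewrite (memNset nu) mul0r.
have sf : sigma_finite setT m.
  exists (fun _ => setT); first by rewrite bigcup_const//; exists 0%N.
  move=> _; split; first exact: measurableT.
  by rewrite (mE _ 0%R 1%R)// ?ltry.
by exists (sigma_finite_wrap sf).
Qed.

(** Preimages of rational rays suffice: [phi] is measurable for the field they generate, and a
    measurable [A] is the preimage of its Borel image. *)
Lemma borel_space_generators (R : realType) d (S : measurableType d) :
  borel_space R S -> exists C : nat -> set S,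
    (forall n, measurable (C n)) /\ @measurable _ S `<=` <<s range C>>.
Proof.
move=> [phi [mphi phiI phiM]].
pose ray (r : rat) : set R := `](ratr r), +oo[%classic.
(* Numbers that code no rational repeat the ray at 0. *)
pose C n : set S := phi @^-1` ray (odflt 0%R (unpickle n)).
exists C; split.
  by move=> n; rewrite -[C n]setTI; apply: mphi => //; exact: measurable_itv.
have mphi' : measurable_fun setT (phi : g_sigma_algebraType (range C) -> R).
  apply: (@measurability _ _ (g_sigma_algebraType (range C)) R setT phi
    (@RGenOInfty.G R)); first exact: RGenOInfty.measurableE.
  move=> _ [_ [x ->] <-]; rewrite setTI.
  rewrite (_ : phi @^-1` _ =
      \bigcup_(r in [set r : rat | (x <= ratr r)%R]) (phi @^-1` ray r)).
    rewrite bigcup_mkcond; apply: bigcupT_measurable_rat => r; case: ifP => // _.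
    by apply: sub_sigma_algebra; exists (pickle r) => //; rewrite /C pickleK.
  apply/seteqP; split => [s /=|s [r /= xr]].
    rewrite in_itv /= andbT => xs.
    have [r] := rat_in_itvoo xs; rewrite in_itv /= => /andP[xr rs].
    by exists r => /=; [exact: ltW|rewrite /ray /= in_itv /= andbT].
  rewrite /ray /= !in_itv /= !andbT; exact: le_lt_trans.
move=> A mA; have -> : A = phi @^-1` (phi @` A).
  by apply/seteqP; split => [s As|s [s' As' /phiI <-]//]; exists s.
rewrite -[_ @^-1` _]setTI; exact: mphi' (phiM _ mA).
Qed.

(** A countable base puts open sets of the product into the product of the Borel fields, which makes
    the continuous multiplication measurable for the latter. *)
Lemma measurable_open_prod (G : ptopologicalType) (U : nat -> set G) :
  (forall n, open (U n)) ->
  (forall (g : G) A, nbhs g A -> exists n, U n g /\ U n `<=` A) ->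
  forall O : set (G * G), open O -> measurable (O : set (borel G * borel G)).
Proof.
move=> oU bU O oO.
rewrite (_ : O = \bigcup_(ij in [set ij : nat * nat | U ij.1 `*` U ij.2 `<=` O])
    (U ij.1 `*` U ij.2)).
  rewrite bigcup_mkcond; apply: countable_bigcupT_measurable => // ij.
  by case: ifP => // _; apply: measurableX; apply: sub_sigma_algebra; exact: oU.
apply/seteqP; split => [[g h] Ogh|p [ij /= ijO ijp]]; last exact: ijO.
have : nbhs (g, h) O by apply: open_nbhs_nbhs; split.
move=> [[A B] /= [gA hB] ABO].
have [i [ig iA]] := bU _ _ gA; have [j [jh jB]] := bU _ _ hB.
exists (i, j) => //= -[x y] [/= xi yj]; apply: ABO; split => /=; [exact: iA|exact: jB].
Qed.

Theorem theorem2p1 (R : realType) (G : ptopologicalType)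
    (mul : G -> G -> G) (inv : G -> G) (e : G)
    (lam : {measure set (borel G) -> \bar R})
    (d : measure_display) (S : measurableType d) (act : G -> S -> S) :
  lcsc_group mul inv e ->
  haar_measure mul lam ->
  borel_space R S ->
  measurable_action mul e act ->
  proper_action act lam ->
  exists kappa : R.-ker (S * S)%type ~> borel G,
    [/\ (forall (s : S) (f : (S * borel G)%type -> \bar R),
           measurable_fun setT f -> (forall x, 0 <= f x) ->
           \int[lam]_g f (act g s, g)
           = \int[orbit_measure act lam s]_t
               \int[kappa (s, t)]_g f (t, g)),
        (forall (g : G) (s t : S) (A : set (borel G)), measurable A ->
           kappa (s, act g t) A = kappa (s, t) [set h | A (mul g h)]),
        (forall s t : S, (exists g : G, act g s = t) ->
           kappa (s, t) (~` [set g : borel G | act g s = t]) = 0) &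
        (forall s t : S, (exists g : G, act g s = t) ->
           kappa (s, t) setT = 1)].
Proof.
move=> [[mulA mul1 mulV] [cmul cinv hG lG sG]] [lamE _ lam0] bS
  [act1 actM mact] [B [mB tB BT Boo]].
have [U [oU bU]] := second_countable_seq sG.
have mmul : measurable_fun setT (fun p : borel G * borel G => mul p.1 p.2 : borel G).
  apply: (measurable_to_borel bU) => n.
  by apply: (measurable_open_prod oU bU); move/continuousP: cmul; exact.
have minv : measurable_fun setT (inv : borel G -> borel G).
  apply: (measurable_to_borel bU) => n; apply: sub_sigma_algebra.
  by move/continuousP: cinv; exact.
have [C [mC genC]] := borel_space_generators bS.
have [phi [mphi phiI _]] := bS.
have [L LE] := uniform_measure R.
(* The orbit map at [point] pulls the partition back to countably many sets of finite Haar measure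
   covering the group. *)
have sf : sigma_finite setT lam.
  exists (fun n => [set g : borel G | B n (act g point)]).
    by apply/seteqP; split => // g _; have : (\bigcup_n B n) (act g point) by rewrite BT.
  move=> n; split; last exact: Boo.
  have ma : measurable_fun setT (fun g : borel G => act g point).
    exact: (measurableT_comp mact (measurable_pair2 point)).
  by rewrite -[X in measurable X]setTI; exact: ma.
have lamT : lam setT != 0 by rewrite gt_eqF.
have [kappa [k1 k2 k3 k4]] := @invariant_disintegration _ _ (borel G) S R mul inv e
  (sigma_finite_wrap sf) act B phi C (code U) (decode U) L mulA mul1 mulV mmul minv
  lamE lamT act1 actM mact mB tB BT Boo mphi phiI mC genC (measurable_code oU)
  (measurable_decode hG lG oU bU) (decodeK hG bU) LE.
exists kappa; split=> //.
by move=> s _ [g <-]; exact: k4.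
Qed.
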